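(* For every real $\varepsilon>0$ there exists $n_0\in\mathbb{N}$ such that for every even integer $n\ge n_0$, the complete graph $K_n$ on $n$ vertices contains a collection of at least $(1-\varepsilon)n$ pairwise edge-disjoint perfect matchings such that any two distinct matchings in the collection form a perfect pair.
   Context: A perfect matching (or $1$-factor) of a graph $G$ is a collection of pairwise vertex-disjoint edges of $G$ which together cover all vertices of $G$. Two perfect matchings on the same vertex set form a perfect pair if their union is a Hamilton cycle, i.e. a cycle spanning the entire vertex set. *)

(* Defs.v *)
From mathcomp Require Import all_boot all_order all_algebra.
From mathcomp Require Import reals.

Set Implicit Arguments.
Unset Strict Implicit.
Unset Printing Implicit Defensive.

(* A simple graph on T is a symmetric irreflexive relation on T; its edges are
   the unordered pairs of adjacent vertices. *)
Definition edges (T : finType) (G : rel T) : {set {set T}} :=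
  [set [set p.1; p.2] | p : T * T & G p.1 p.2].

Definition complete_graph (n : nat) : rel 'I_n := fun x y => x != y.

Definition perfect_matching (T : finType) (G : rel T) (M : {set {set T}}) : Prop :=
  M \subset edges G /\ partition M [set: T].

(* [E] is the edge set of a cycle, of length at least 3, spanning [T]. *)
Definition hamilton_cycle (T : finType) (E : {set {set T}}) : Prop :=
  exists c : seq T,
    [/\ 2 < size c, uniq c, (forall x, x \in c)
      & E = [set [set x; next c x] | x in c]].

Definition perfect_pair (T : finType) (M N : {set {set T}}) : Prop :=
  hamilton_cycle (M :|: N).

(* Main.v *)
(* Let p be an odd prime. On the union of F_p and a point oo, the reflections x -> 2i - x,
   with oo matched to i, give p perfect matchings M_i such that every M_i u M_j is a
   Hamilton cycle. Given a symmetric set A of nonzero residues, replace in each M_i the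
   edge {i + a, i - a}, for a in A, by the two edges from i + a and i - a to new vertices
   a and - a. The union of two modified matchings is still connected, hence still a
   Hamilton cycle; this yields p pairwise perfect matchings on p + 1 + |A| vertices.

   It remains to find a prime in ((1 - eps) n, n). This follows Erdos: start from Selberg's
   formula psi(x) ln x + sum_{m <= x} Lambda(m) psi(x / m) = 2 x ln x + O(x). Suppose psi
   grows linearly on all intervals (x, c x] but fails to do so on some (x, y] with y about
   (1 + 9 (c - 1) / 10) x. Then for almost all m (weighted by Lambda(m) / m) the interval
   (x / m, y / m] carries the maximal density 2 allowed by Selberg's formula. Chaining
   these intervals, whose left ends have ratios at most about c, gives a long interval
   whose density exceeds 8/5, against Chebyshev's bound. Hence c may be replaced by
   1 + 9 (c - 1) / 10, and by iteration by any number above 1. *)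
Require Import Defs.
From mathcomp Require Import all_boot all_order all_algebra.
From mathcomp Require classical_sets.
From mathcomp Require Import boolp reals sequences exp.
From mathcomp Require Import zify ring lra.

Set Implicit Arguments.
Unset Strict Implicit.
Unset Printing Implicit Defensive.

(** * Perfect matchings as fixed-point-free involutions *)

Section InvolutionPairs.
Variable T : finType.
Implicit Types f g : T -> T.

Definition fpf_involution f := involutive f /\ (forall x, f x != x).

Definition matching_of f : {set {set T}} := [set [set x; f x] | x : T].

(** This is connectedness of the union of the two matchings. Such a union consists of alternating
    cycles and shared edges, so on more than two points connectedness leaves a single Hamilton
    cycle. *)
Definition jointly_transitive f g := forall (S : {set T}) x0, x0 \in S ->
  (forall x, x \in S -> (f x \in S) && (g x \in S)) -> S = setT.

Lemma mem_matching_of f x : [set x; f x] \in matching_of f.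
Proof. exact: imset_f. Qed.

Lemma matching_ofP f x y : involutive f ->
  ([set x; y] \in matching_of f) -> x != y -> y = f x.
Proof.
move=> fK /imsetP[z _ E] xy.
have : x \in [set z; f z] by rewrite -E set21.
have : y \in [set z; f z] by rewrite -E set22.
rewrite !inE => /orP[]/eqP ey /orP[]/eqP ex; move: xy; rewrite ex ey ?fK ?eqxx //.
Qed.

Lemma perfect_matching_of f (G : rel T) : fpf_involution f ->
  (forall x, G x (f x)) -> perfect_matching G (matching_of f).
Proof.
move=> [fK f0] Gf; split.
  apply/subsetP => _ /imsetP[x _ ->]; apply/imsetP; exists (x, f x) => //.
  by rewrite inE.
apply/and3P; split.
- apply/eqP/setP => x; rewrite inE; apply/bigcupP.
  by exists [set x; f x]; rewrite ?mem_matching_of // set21.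
- apply/trivIsetP => _ _ /imsetP[x _ ->] /imsetP[y _ ->].
  apply: contraR; rewrite -setI_eq0 => /set0Pn[z]; rewrite !inE => /andP[].
  by case/orP=> /eqP-> /orP[]/eqP => [->|->|<-|/(can_inj fK)->]; rewrite ?fK // setUC.
- apply/imsetP => -[x _ /setP/(_ x)]; by rewrite !inE eqxx.
Qed.

Section Pair.
Variables f g : T -> T.
Hypotheses (ff : fpf_involution f) (gf : fpf_involution g).
Hypothesis fg : jointly_transitive f g.

Let h x := g (f x).

(* Cancelling [h] from both ends moves such a coincidence to the middle of the
   path, where it becomes a fixed point of [f] or of [g]. *)
Lemma iter_comp_neq n : (forall x, f x <> iter n h x) /\ (forall x, f x <> iter n.+1 h x).
Proof.
case: ff gf => fK f0 [gK g0].
elim: n => [|n [IH1 IH2]]; first by split=> x /esym/eqP; apply/negP; [rewrite eq_sym f0 | exact: g0].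
split=> // x; rewrite iterS => E; apply: (IH1 (h x)).
by rewrite -iterSr; move: (congr1 (fun y => f (g y)) E); rewrite /= {2}/h gK fK.
Qed.

(* [T] is the disjoint union of the orbit [O] of [h] and of its image under [f]; the
   cycle follows [f] on [O] and [g] off [O]. *)
Lemma hamilton_cycle_pair : 2 < #|T| ->
  hamilton_cycle (matching_of f :|: matching_of g).
Proof.
move=> T2; case: (ff) (gf) => fK f0 [gK g0].
have /card_gt0P[x0 _] : 0 < #|T| by apply: leq_trans T2.
have hI : injective h := inj_comp (can_inj gK) (can_inj fK).
pose O := [set x | fconnect h x0 x].
have hO x : (h x \in O) = (x \in O) by rewrite !inE -same_fconnect1_r.
have O0 : x0 \in O by rewrite inE connect0.
have Of x : x \in O -> f x \notin O.
  rewrite !inE fconnect_sym // => Ox; apply/negP => Ofx.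
  have /iter_findex E := connect_trans Ox Ofx.
  by case: (iter_comp_neq (findex h x (f x))) => /(_ x); rewrite E.
have Oh x : x \in O -> fconnect h x0 x by rewrite inE.
clearbody O.
have fgO x : (f (g x) \in O) = (x \in O) by rewrite -hO /h fK gK.
have OU x : (x \in O) || (f x \in O).
  suff /setP/(_ x) : [set x | (x \in O) || (f x \in O)] = setT by rewrite in_set in_setT.
  apply: (fg (x0 := x0)) => [|y]; first by rewrite in_set O0.
  by rewrite !in_set fK fgO -[y in g y]fK -/(h _) hO orbC => ->.
have OfN x : (f x \in O) = (x \notin O).
  by apply/idP/idP => [/Of|]; [rewrite fK | case/orP: (OU x) => ->].
have OgN x : (g x \in O) = (x \notin O) by rewrite -(fgO x) OfN negbK.
pose s x := if x \in O then f x else g x.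
pose s' x := if x \in O then g x else f x.
have sO x : (s x \in O) = (x \notin O).
  by rewrite /s; case: ifP => xO; rewrite ?OfN ?OgN xO.
have sK : cancel s s'.
  by move=> x; rewrite /s' sO /s; case: (x \in O); rewrite /= ?fK ?gK.
have sI := can_inj sK.
(* Two steps of [s] from a point of [O] make one step of [h], so the orbit of [s] covers [O]; a
   point off [O] is the image under [s] of its [f]-partner. *)
have sall x : x \in orbit s x0.
  have hs y : y \in O -> h y = s (s y) by move=> yO; rewrite {1}/s sO yO /s yO.
  have Osub y : y \in O -> fconnect s x0 y.
    move/Oh/iter_findex <-; elim: (findex _ _ _) => [|n IH] //=.
    have nO : iter n h x0 \in O by elim: (n) => //= m; rewrite hO.
    by rewrite hs // -!same_fconnect1_r.
  rewrite -fconnect_orbit; case/orP: (OU x) => [/Osub //|fxO].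
  by rewrite -(fK x) (_ : f (f x) = s (f x)) -?same_fconnect1_r ?Osub // /s fxO.
exists (orbit s x0); split=> //.
  rewrite -(card_uniqP (orbit_uniq s x0)); apply: leq_trans T2 _.
  by apply/subset_leq_card/subsetP => x _; exact: sall.
have E : [set [set x; next (orbit s x0) x] | x in orbit s x0] = [set [set x; s x] | x in T].
  apply/setP => e; apply/imsetP/imsetP => -[x _ ->]; exists x => //.
  - by rewrite (eqP (next_cycle (cycle_orbit sI x0) (sall x))).
  - by rewrite (eqP (next_cycle (cycle_orbit sI x0) (sall x))).
(* Every edge of either matching has exactly one endpoint in [O]; an [f]-edge is read from that
   endpoint, a [g]-edge from the other one. *)
rewrite E; apply/setP => e; rewrite in_setU; apply/orP/imsetP => [[]/imsetP[x _ ->]|[x _ ->]].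
- case xO: (x \in O); first by exists x => //; rewrite /s xO.
  by exists (f x) => //; rewrite /s OfN xO fK setUC.
- case xO: (x \in O); last by exists x => //; rewrite /s xO.
  by exists (g x) => //; rewrite /s OgN xO gK setUC.
- by rewrite /s; case: ifP => _; [left|right]; exact: imset_f.
Qed.

(** A common edge would be a two-element set closed under both involutions, hence all of [T]. *)
Lemma disjoint_pair : 2 < #|T| -> [disjoint matching_of f & matching_of g].
Proof.
move=> T2; case: (ff) (gf) => fK f0 [gK g0].
rewrite disjoints_subset; apply/subsetP => _ /imsetP[x _ ->]; rewrite inE.
apply/negP => /(matching_ofP gK); rewrite eq_sym f0 => /(_ isT) E.
have /setP S : [set x; f x] = setT.
  apply: (fg (x0 := x)) => [|y]; rewrite !inE ?eqxx // => /orP[]/eqP ->; rewrite ?fK -?E ?eqxx ?orbT //.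
  by rewrite E gK eqxx.
have := cardsT T; have -> : [set: T] = [set x; f x] by apply/setP.
by move: T2; rewrite cards2 => + E2; rewrite -E2; case: (_ == _).
Qed.
End Pair.

Lemma matching_family (I : finType) (M : I -> T -> T) : 2 < #|T| ->
  (forall i, fpf_involution (M i)) ->
  (forall i j, i != j -> jointly_transitive (M i) (M j)) ->
  exists F : {set {set {set T}}},
    [/\ #|F| = #|I|,
        forall N, N \in F -> perfect_matching (fun x y => x != y) N,
        forall N N', N \in F -> N' \in F -> N != N' -> [disjoint N & N']
      & forall N N', N \in F -> N' \in F -> N != N' -> perfect_pair N N'].
Proof.
move=> T2 Mf Mt; exists [set matching_of (M i) | i : I].
have MI : injective (fun i => matching_of (M i)).
  move=> i j E; apply/eqP/negPn/negP => /Mt/(disjoint_pair (Mf i) (Mf j))/(_ T2).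
  have /card_gt0P[x _] : 0 < #|T| by apply: leq_trans T2.
  by rewrite -E -setI_eq0 setIid => /eqP/setP/(_ [set x; M i x]); rewrite mem_matching_of inE.
split; first exact: card_imset.
- move=> _ /imsetP[i _ ->]; apply: perfect_matching_of => // x.
  by rewrite eq_sym; case: (Mf i).
- move=> _ _ /imsetP[i _ ->] /imsetP[j _ ->]; rewrite (inj_eq MI) => ij.
  exact: disjoint_pair (Mt _ _ ij) _.
- move=> _ _ /imsetP[i _ ->] /imsetP[j _ ->]; rewrite (inj_eq MI) => ij.
  exact: hamilton_cycle_pair (Mt _ _ ij) _.
Qed.

End InvolutionPairs.

(** * Reflections of a prime field with subdivided edges *)

Section SubdividedReflections.
Import GRing.Theory.
Local Open Scope ring_scope.

(** Nonzero elements are added in pairs x, - x, which are distinct because 2 is nonzero. *)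
Lemma symmetric_subset (F : finFieldType) k : (2%:R : F) != 0 -> (k.*2 < #|F|)%N ->
  exists A : {set F}, [/\ #|A| = k.*2, 0 \notin A & forall x, x \in A -> - x \in A].
Proof.
move=> F2; elim: k => [|k IH] kF.
  by exists set0; split=> [||x]; rewrite ?cards0 ?inE.
case: IH => [|A [cA A0 Aopp]]; first by apply: leq_trans kF; rewrite doubleS ltnS leqW.
have /set0Pn[x] : ~: (0 |: A) != set0.
  by rewrite -card_gt0 cardsCs setCK cardsU1 A0 cA subn_gt0; apply: leq_ltn_trans kF; rewrite doubleS leqW.
rewrite !inE negb_or => /andP[x0 xA].
have xN : x != - x by rewrite -subr_eq0 opprK -mulr2n -mulr_natl mulf_neq0.
have NxA : - x \notin A by apply: contra xA => /Aopp; rewrite opprK.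
exists (x |: (- x |: A)); split=> [||y].
- by rewrite !cardsU1 !inE (negbTE xN) (negbTE NxA) (negbTE xA) /= cA !add1n doubleS.
- by rewrite !inE ![0 == _]eq_sym oppr_eq0 (negbTE x0).
- by rewrite !inE => /or3P[/eqP->|/eqP->|/Aopp->]; rewrite ?opprK ?eqxx ?orbT.
Qed.

Variables (p : nat) (p_pr : prime p) (A : {set 'F_p}).
Hypothesis p2 : (2%:R : 'F_p) != 0.
Hypotheses (A0 : 0 \notin A) (Aopp : forall x, x \in A -> - x \in A).

Definition subdivided_vertex := (option 'F_p + {x | x \in A})%type.

(* [None] is the point at infinity. The matching is the reflection of ['F_p] in
   [i], which matches [i] itself with infinity, except that [i + a] is matched
   with the new vertex [a] for [a] in [A]. *)
Definition subdivided_reflection (i : 'F_p) (v : subdivided_vertex) : subdivided_vertex :=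
  match v with
  | inl None => inl (Some i)
  | inl (Some x) => if x == i then inl None
                    else if insub (x - i) is Some w then inr w
                    else inl (Some (i + i - x))
  | inr w => inl (Some (i + val w))
  end.

Let M := subdivided_reflection.

Lemma subdivided_reflection_in i (x : 'F_p) (xA : x \in A) :
  M i (inl (Some (i + x))) = inr (Sub x xA).
Proof.
have x0 : x != 0 by apply: contraNneq A0 => <-.
by rewrite /M /= -subr_eq0 [i + x]addrC addrK (negbTE x0) insubT.
Qed.

Lemma subdivided_reflection_notin i (x : 'F_p) : x \notin A -> x != 0 ->
  M i (inl (Some (i + x))) = inl (Some (i - x)).
Proof.
move=> xA x0; rewrite /M /= -subr_eq0 [i + x]addrC addrK (negbTE x0) insubN //.
by congr (inl (Some _)); ring.
Qed.

Lemma subdivided_reflection_fpf i : fpf_involution (M i).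
Proof.
have M0 : M i (inl (Some i)) = inl None by rewrite /M /= eqxx.
have cases x : [\/ x = i, exists2 y, y \in A & x = i + y | exists y, [/\ y \notin A, y != 0 & x = i + y]].
  have [->|xi] := eqVneq x i; first by constructor 1.
  have E : x = i + (x - i) by ring.
  have [xA|xA] := boolP (x - i \in A); [constructor 2 | constructor 3]; exists (x - i) => //.
  by split=> //; rewrite subr_eq0.
split=> [] [[x|]|w] //.
- case: (cases x) => [->|[y yA ->]|[y [yA y0 ->]]]; first by rewrite M0.
    by rewrite subdivided_reflection_in.
  rewrite subdivided_reflection_notin // subdivided_reflection_notin ?oppr_eq0 ?opprK //.
  by apply: contra yA => /Aopp; rewrite opprK.
- by case: w => y yA; rewrite [M i (inr _)]/= subdivided_reflection_in.
- case: (cases x) => [->|[y yA ->]|[y [yA y0 ->]]]; first by rewrite M0.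
    by rewrite subdivided_reflection_in.
  rewrite subdivided_reflection_notin //; apply/eqP => E.
  have /eqP := addrI _ (Some_inj (inl_inj E)).
  by rewrite eq_sym -subr_eq0 opprK -mulr2n -mulr_natl mulf_eq0 (negbTE y0) (negbTE p2).
Qed.

(* With [d = j - i], the matchings of [i] and [j] lead from [i + t d] and [j - t d] to
   [j - (t + 1) d] and [i + (t + 1) d] respectively; when [t d] lies in [A] both steps
   are replaced by two-step paths through the vertices [t d] and [- t d], which exchange
   the two endpoints. So all points of ['F_p] are linked to infinity. *)
Lemma subdivided_reflection_transitive i j : i != j -> jointly_transitive (M i) (M j).
Proof.
move=> ij; pose d := j - i.
have full (S : {set subdivided_vertex}) : inl None \in S ->
    (forall x, x \in S -> (M i x \in S) && (M j x \in S)) -> S = setT.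
  move=> S0 SM.
  have SMi x : x \in S -> M i x \in S by move/SM/andP => [].
  have SMj x : x \in S -> M j x \in S by move/SM/andP => [].
  have step t : (inl (Some (i + d *+ t)) \in S) /\ (inl (Some (j - d *+ t)) \in S).
    elim: t => [|t [IHi IHj]].
      by rewrite mulr0n addr0 subr0; split; [exact: (SMi _ S0) | exact: (SMj _ S0)].
    have -> : i + d *+ t.+1 = j + d *+ t by rewrite mulrS /d; ring.
    have -> : j - d *+ t.+1 = i - d *+ t by rewrite mulrS /d; ring.
    have [tA|tA] := boolP (d *+ t \in A).
      split; first by move: (SMj _ (SMi _ IHi)); rewrite subdivided_reflection_in.
      by move: (SMi _ (SMj _ IHj)); rewrite (subdivided_reflection_in _ (Aopp tA)).
    (* If t d = 0, the next two points are j and i, which the induction hypothesis already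
       supplies. *)
    have [t0|t0] := eqVneq (d *+ t) 0.
      by split; [move: IHj | move: IHi]; rewrite t0 ?subr0 ?addr0.
    split; last by move: (SMi _ IHi); rewrite subdivided_reflection_notin.
    move: (SMj _ IHj); rewrite subdivided_reflection_notin ?oppr_eq0 ?opprK //.
    by apply: contra tA => /Aopp; rewrite opprK.
  have d0 : d != 0 by rewrite subr_eq0 eq_sym.
  have SSome x : inl (Some x) \in S.
    have [+ _] := step (val ((x - i) / d)).
    by rewrite -mulr_natl natr_Zp divfK // addrC subrK.
  apply/setP => -[[x|]|w]; rewrite inE ?SSome //.
  have := SMi _ (SSome (i + val w)).
  by rewrite (subdivided_reflection_in _ (valP w)) (_ : Sub _ _ = w) //; apply: val_inj; rewrite SubK.
(* If infinity is not in [S], it lies in the complement, which is closed as well because the maps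
   are involutions; then the complement is everything, against [x0] in [S]. *)
move=> S x0 S0 SM; have [|N0] := boolP (inl None \in S); first by move/full; apply.
have /setP/(_ x0) : ~: S = setT.
  apply: full => [|x]; first by rewrite inE.
  rewrite !inE => xS; apply/andP; split; apply: contra xS => /SM/andP[].
    by case: (subdivided_reflection_fpf i) => ->.
  by case: (subdivided_reflection_fpf j) => -> _.
by rewrite !inE S0.
Qed.

Lemma card_subdivided_vertex : #|{: subdivided_vertex}| = (p + 1 + #|A|)%N.
Proof. by rewrite card_sum card_option card_Fp // card_sig addn1. Qed.

End SubdividedReflections.

Lemma jointly_transitive_conj (T U : finType) (e : T -> U) (e' : U -> T) f g :
  cancel e e' -> cancel e' e -> jointly_transitive f g ->
  jointly_transitive (e \o f \o e') (e \o g \o e').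
Proof.
move=> eK e'K fg S x0 S0 SM.
have /setP E : [set x | e x \in S] = setT.
  apply: (fg _ (e' x0)) => [|x]; rewrite !inE ?e'K //.
  by move=> /SM /=; rewrite !eK.
by apply/setP => y; rewrite -[y]e'K; move: (E (e' y)); rewrite !inE.
Qed.

Lemma perfect_family_of_prime p k : prime p -> odd p -> (k.*2 < p)%N ->
  exists F : {set {set {set 'I_(p + 1 + k.*2)}}},
    [/\ #|F| = p,
        forall M, M \in F -> perfect_matching (@complete_graph _) M,
        forall M N, M \in F -> N \in F -> M != N -> [disjoint M & N]
      & forall M N, M \in F -> N \in F -> M != N -> perfect_pair M N].
Proof.
move=> p_pr p_odd kp.
have p2 : (2%:R : 'F_p)%R != 0%R.
  rewrite -(GRing.dvdn_pcharf (pchar_Fp p_pr)) dvdn_prime2 //.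
  by apply: contraTneq p_odd => ->.
have [|A [cA A0 Aopp]] := @symmetric_subset 'F_p k p2; first by rewrite card_Fp.
rewrite -cA -(card_subdivided_vertex p_pr A).
set V := subdivided_vertex A.
pose M (i : 'F_p) (x : 'I_#|{: V}|) : 'I_#|{: V}| := enum_rank (subdivided_reflection i (enum_val x)).
have [|i|i j ij|F [cF F1 F2 F3]] := @matching_family _ _ M; last first.
- by exists F; split=> //; rewrite cF card_Fp.
- apply: (@jointly_transitive_conj V _ enum_rank enum_val); [exact: enum_rankK | exact: enum_valK |].
  exact: subdivided_reflection_transitive.
- case: (subdivided_reflection_fpf p2 A0 Aopp i) => MK M0; split=> x.
    by rewrite /M /= enum_rankK MK enum_valK.
  by rewrite /M /= -(inj_eq enum_val_inj) enum_rankK M0.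
- by rewrite card_ord card_subdivided_vertex //; apply: leq_trans (leq_addr _ _); rewrite addn1 ltnS prime_gt1.
Qed.

(** * Selberg's formula *)

Import Order.TTheory GRing.Theory Num.Theory.
Local Open Scope ring_scope.

(** * Rearrangement of sums over divisors *)

Section DirichletSums.
Variable V : nmodType.

Lemma sum_multiples (F : nat -> V) d N : (0 < d)%N ->
  \sum_(1 <= m < N.+1 | (d %| m)%N) F m = \sum_(1 <= e < (N %/ d).+1) F (d * e)%N.
Proof.
move=> d0; elim: N => [|N IH]; first by rewrite div0n !big_geq.
rewrite big_mkcond big_nat_recr //= -big_mkcond /= IH divnS //.
case: ifP => dN; last by rewrite addr0.
rewrite add1n [RHS]big_nat_recr //=; congr (_ + F _).
by rewrite -[LHS](divnK dN) mulnC divnS // dN.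
Qed.

(** Put m = d e: both sides run over the pairs with d e at most N. *)
Lemma sum_divisors_swap (G : nat -> nat -> V) N :
  \sum_(1 <= m < N.+1) \sum_(1 <= d < m.+1 | (d %| m)%N) G d (m %/ d)%N =
  \sum_(1 <= d < N.+1) \sum_(1 <= e < (N %/ d).+1) G d e.
Proof.
transitivity (\sum_(1 <= m < N.+1) \sum_(1 <= d < N.+1 | (d %| m)%N) G d (m %/ d)%N).
  apply: eq_big_nat => m /andP[m1 mN].
  rewrite (big_nat_widen _ _ N.+1) //; apply: eq_bigl => d.
  by case: (boolP (d %| m)%N) => //= /(dvdn_leq m1) dm; rewrite ltnS dm.
rewrite (exchange_big_dep xpredT) //=; apply: eq_big_nat => d /andP[d1 _].
rewrite (sum_multiples (fun m => G d (m %/ d)%N)) //.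
by apply: eq_bigr => e _; rewrite mulKn.
Qed.

Lemma sum_hyperbola_sym (G : nat -> nat -> V) N :
  \sum_(1 <= d < N.+1) \sum_(1 <= e < (N %/ d).+1) G d e =
  \sum_(1 <= e < N.+1) \sum_(1 <= d < (N %/ e).+1) G d e.
Proof.
have E (H : nat -> nat -> V) : \sum_(1 <= d < N.+1) \sum_(1 <= e < (N %/ d).+1) H d e =
    \sum_(1 <= d < N.+1) \sum_(1 <= e < N.+1 | (d * e <= N)%N) H d e.
  apply: eq_big_nat => d /andP[d1 _].
  rewrite (big_nat_widen _ _ N.+1) ?ltnS ?leq_div //; apply: eq_bigl => e /=.
  by rewrite ltnS leq_divRL // mulnC.
rewrite E [RHS]E (exchange_big_dep xpredT) //=; apply: eq_bigr => e _.
by apply: eq_bigl => d; rewrite mulnC.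
Qed.

Lemma sum_divisors_sym (G : nat -> nat -> V) n : (0 < n)%N ->
  \sum_(1 <= d < n.+1 | (d %| n)%N) \sum_(1 <= e < (n %/ d).+1 | (e %| n %/ d)%N) G d e =
  \sum_(1 <= e < n.+1 | (e %| n)%N) \sum_(1 <= d < (n %/ e).+1 | (d %| n %/ e)%N) G d e.
Proof.
move=> n0.
have E (H : nat -> nat -> V) :
    \sum_(1 <= d < n.+1 | (d %| n)%N) \sum_(1 <= e < (n %/ d).+1 | (e %| n %/ d)%N) H d e =
    \sum_(1 <= d < n.+1) \sum_(1 <= e < n.+1 | (d * e %| n)%N) H d e.
  rewrite big_mkcond; apply: eq_big_nat => d /andP[d1 _].
  case: ifP => [dn|/negbT dn].
    rewrite (big_nat_widen _ _ n.+1) ?ltnS ?leq_div //; apply: eq_bigl => e /=.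
    rewrite dvdn_divRL // mulnC; case: (boolP (d * e %| n)%N) => //= den.
    by rewrite ltnS leq_divRL // mulnC dvdn_leq.
  rewrite big_pred0 // => e; apply: contraNF dn.
  exact: dvdn_trans (dvdn_mulr _ _).
rewrite E [RHS]E (exchange_big_dep xpredT) //=; apply: eq_bigr => e _.
by apply: eq_bigl => d; rewrite mulnC.
Qed.

End DirichletSums.

(** * The von Mangoldt function and its summatory function *)

Section PrimesInShortIntervals.
Variable R : realType.

Definition mangoldt (n : nat) : R :=
  if (1 < n)%N && (n == (pdiv n ^ logn (pdiv n) n)%N) then ln (pdiv n)%:R else 0.

Lemma mangoldt_ge0 n : 0 <= mangoldt n.
Proof.
rewrite /mangoldt; case: ifP => // /andP[n1 _].
by rewrite ln_ge0 // ler1n pdiv_gt0.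
Qed.

Lemma mangoldt_prime_power p k : prime p -> mangoldt (p ^ k.+1) = ln p%:R.
Proof.
move=> p_pr; rewrite /mangoldt pdiv_pfactor // pfactorK // eqxx andbT.
by rewrite -{1}(exp1n k.+1) ltn_exp2r // prime_gt1.
Qed.

(** At most one pair (p, k) with k positive represents n. The ranges depend on [N] only, so that
    this double sum can be exchanged with a sum over n. *)
Lemma mangoldt_sum n N : (0 < n <= N)%N -> mangoldt n =
  \sum_(1 <= p < N.+1 | prime p) \sum_(1 <= k < N.+1 | n == (p ^ k)%N) ln p%:R.
Proof.
move=> /andP[n0 nN].
case: (boolP ((1 < n)%N && (n == (pdiv n ^ logn (pdiv n) n)%N))) => [/andP[n1 /eqP E]|H].
  have p_pr := pdiv_prime n1.
  have k0 : (0 < logn (pdiv n) n)%N by rewrite logn_gt0 mem_primes p_pr n0 pdiv_dvd.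
  move: E p_pr k0; move: (pdiv n) (logn _ _) => p [|k] // E p_pr _.
  have pn : (p < N.+1)%N.
    by rewrite ltnS; apply: leq_trans nN; rewrite E -{1}(expn1 p) leq_pexp2l // prime_gt0.
  have kn : (k.+1 < N.+1)%N.
    by rewrite ltnS; apply: leq_trans nN; rewrite E; apply/ltnW/ltn_expl/prime_gt1.
  rewrite E mangoldt_prime_power // (big_rem p) ?mem_index_iota ?prime_gt0 //= p_pr.
  rewrite (big_rem k.+1) ?mem_index_iota //= eqxx.
  rewrite !big1_seq ?addr0 // => [q|j].
    move=> /andP[q_pr]; rewrite mem_rem_uniq ?iota_uniq // inE => /andP[qp _].
    rewrite big1 // => j /eqP Ej; case/eqP: qp.
    have : (p %| q ^ j)%N by rewrite -Ej dvdn_exp.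
    by rewrite Euclid_dvdX // => /andP[+ _]; rewrite dvdn_prime2 // => /eqP.
  move=> /andP[/eqP Ej]; rewrite mem_rem_uniq ?iota_uniq // inE => /andP[/eqP jk _].
  by case: jk; apply: (expnI (prime_gt1 p_pr)).
rewrite /mangoldt (negbTE H) big1 // => p p_pr; rewrite big_seq_cond big1 // => k.
rewrite mem_index_iota => /andP[/andP[k0 _] /eqP E]; case/negP: H.
case: k k0 E => // k _ ->; rewrite pdiv_pfactor // pfactorK // eqxx andbT.
by rewrite -{1}(exp1n k.+1) ltn_exp2r // prime_gt1.
Qed.

Lemma ln_prod_nat (I : eqType) (r : seq I) (P : pred I) (F : I -> nat) :
  (forall i, P i -> 0 < F i)%N ->
  ln (\prod_(i <- r | P i) F i)%:R = \sum_(i <- r | P i) ln (F i)%:R :> R.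
Proof.
move=> F0; elim: r => [|i r IH]; first by rewrite !big_nil ln1.
rewrite !big_cons; case: ifP => // Pi.
by rewrite natrM lnM ?IH // posrE ltr0n ?F0 // prodn_cond_gt0.
Qed.

Lemma ln_logn n : (0 < n)%N ->
  ln n%:R = \sum_(1 <= p < n.+1 | prime p) (logn p n)%:R * ln p%:R :> R.
Proof.
move=> n0; rewrite -{1}(partnT n0) /partn ln_prod_nat => [|p _]; last first.
  by rewrite expn_gt0; case: p => // ; rewrite lognE.
rewrite big_ltn // /= {1}lognE /= expn0 ln1 add0r [RHS]big_mkcond /=.
apply: eq_big_nat => p /andP[p0 _]; case: ifP => pr.
  by rewrite natrX lnXn ?ltr0n // mulr_natl.
by rewrite lognE pr /= expn0 ln1.
Qed.

(** For each prime p, exactly [logn p n] of the powers p ^ k with k positive divide n. *)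
Lemma sum_mangoldt_divisors n : (0 < n)%N ->
  \sum_(1 <= d < n.+1 | (d %| n)%N) mangoldt d = ln n%:R.
Proof.
move=> n0; rewrite ln_logn //.
transitivity (\sum_(1 <= d < n.+1 | (d %| n)%N)
    \sum_(1 <= p < n.+1 | prime p) \sum_(1 <= k < n.+1 | d == (p ^ k)%N) (ln p%:R : R)).
  rewrite big_nat_cond [RHS]big_nat_cond; apply: eq_bigr => d /andP[/andP[d1 dn] _].
  by rewrite (@mangoldt_sum d n) // d1.
rewrite (exchange_big_dep prime) //=; apply: eq_bigr => p p_pr.
rewrite (exchange_big_dep xpredT) //=.
rewrite (eq_big_nat _ _ (F2 := fun k => if (k <= logn p n)%N then ln p%:R else 0 : R)).
  rewrite -big_mkcond /= (eq_bigl (fun k => (k < (logn p n).+1)%N)) //.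
  have ln_n : ((logn p n).+1 <= n.+1)%N by rewrite ltnS ltnW // ltn_logl.
  rewrite -(big_nat_widen _ _ _ predT) //.
  by rewrite big_const_nat iter_addr addr0 subn1 mulr_natl.
move=> k /andP[k0 kn]; rewrite -pfactor_dvdn // big_nat1_cond_eq.
rewrite expn_gt0 prime_gt0 //=; case: (boolP (p ^ k %| n)%N) => pkn; rewrite ?andbF ?andbT //.
by rewrite ltnS dvdn_leq ?p_pr.
Qed.

Definition psi (N : nat) : R := \sum_(1 <= m < N.+1) mangoldt m.

Lemma psi_mono M N : (M <= N)%N -> psi M <= psi N.
Proof.
move=> MN; rewrite /psi (@big_cat_nat _ _ _ M.+1 1 N.+1) //= lerDl.
by rewrite sumr_ge0 // => i _; exact: mangoldt_ge0.
Qed.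

Lemma psi_ge0 N : 0 <= psi N.
Proof. by rewrite sumr_ge0 // => i _; exact: mangoldt_ge0. Qed.

Lemma ln_fact N : ln N`!%:R = \sum_(1 <= m < N.+1) ln m%:R :> R.
Proof.
by rewrite fact_prod big_nat_cond ln_prod_nat -?big_nat_cond // => i /andP[/andP[]].
Qed.

Lemma ln_fact_mangoldt N :
  ln N`!%:R = \sum_(1 <= m < N.+1) mangoldt m * (N %/ m)%:R.
Proof.
rewrite ln_fact (eq_big_nat _ _ (F2 := fun m =>
  \sum_(1 <= d < m.+1 | (d %| m)%N) mangoldt d)); last first.
  by move=> m /andP[m1 _]; rewrite sum_mangoldt_divisors.
rewrite (sum_divisors_swap (fun d _ => mangoldt d)); apply: eq_bigr => d _.
by rewrite big_const_nat iter_addr addr0 subn1 mulr_natr.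
Qed.

Lemma ln_fact_psi N : ln N`!%:R = \sum_(1 <= e < N.+1) psi (N %/ e).
Proof.
rewrite ln_fact_mangoldt -(sum_hyperbola_sym (fun d _ => mangoldt d)).
apply: eq_bigr => d _.
by rewrite big_const_nat iter_addr addr0 subn1 mulr_natr.
Qed.

(** * Elementary bounds for logarithms and factorials *)

Lemma ln_le_subr1 (x : R) : 0 < x -> ln x <= x - 1.
Proof.
move=> x0; have := @le_ln1Dx R (x - 1); rewrite [1 + _]addrC subrK; apply; lra.
Qed.

Lemma ln_diff_le (x y : R) : 0 < x -> 0 < y -> ln y - ln x <= (y - x) / x.
Proof.
move=> x0 y0; rewrite -ln_div ?posrE //; apply: le_trans (ln_le_subr1 _) _; first by rewrite divr_gt0.
by rewrite mulrBl divff // gt_eqF.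
Qed.

(** Apply ln u <= u - 1 to u = eta x. *)
Lemma ln_le_linear (eta : R) : 0 < eta ->
  exists2 C : R, 0 <= C & forall x, 0 < x -> ln x <= eta * x + C.
Proof.
move=> e0; exists `|ln eta|; first exact: normr_ge0.
move=> x x0; have := ln_le_subr1 (mulr_gt0 e0 x0); rewrite lnM ?posrE //.
have := ler_norm (- ln eta); rewrite normrN; lra.
Qed.

Lemma ln_nat_ge0 n : 0 <= ln n%:R :> R.
Proof. by case: n => [|n]; [rewrite ln0 | rewrite ln_ge0 ?ler1n]. Qed.

Lemma ln_succ_sub_le n : (0 < n)%N -> ln n.+1%:R - ln n%:R <= n%:R^-1 :> R.
Proof.
move=> n0; apply: le_trans (ln_diff_le _ _) _; rewrite ?ltr0n //.
by rewrite -natrB // subSnn mul1r.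
Qed.

Lemma ln_succ_sub_ge n : (0 < n)%N -> n.+1%:R^-1 <= ln n.+1%:R - ln n%:R :> R.
Proof.
move=> n0; have := @ln_diff_le n.+1%:R n%:R; rewrite !ltr0n n0 => /(_ isT isT).
by rewrite -[n%:R - _]opprB -natrB // subSnn mulN1r lerNr opprB.
Qed.

Lemma ln_fact_ge n : (0 < n)%N -> n%:R * ln n%:R - n%:R <= ln n`!%:R :> R.
Proof.
case: n => // n _; elim: n => [|n IH]; first by rewrite factS fact0 muln1 ln1; lra.
rewrite factS natrM lnM ?posrE ?ltr0n ?fact_gt0 //.
have := @ln_succ_sub_le n.+1 isT; have n0 : 0 < n.+1%:R :> R by rewrite ltr0n.
rewrite -(ler_pM2l n0) divff ?gt_eqF // [n.+2%:R]mulrS; lra.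
Qed.

Lemma ln_fact_le n : (0 < n)%N ->
  ln n`!%:R <= n%:R * ln n%:R - n%:R + (1 + ln n%:R) :> R.
Proof.
case: n => // n _; elim: n => [|n IH]; first by rewrite factS fact0 muln1 ln1; lra.
rewrite factS natrM lnM ?posrE ?ltr0n ?fact_gt0 //.
have := @ln_succ_sub_ge n.+1 isT; have n0 : 0 < n.+2%:R :> R by rewrite ltr0n.
rewrite -(ler_pM2l n0) divff ?gt_eqF // [n.+2%:R]mulrS; lra.
Qed.

(** * Chebyshev's bounds through central binomial coefficients *)

Lemma ln_central_binomial h : ln 'C(h.*2, h)%:R =
  \sum_(1 <= m < h.*2.+1) mangoldt m * ((h.*2 %/ m)%:R - 2 * (h %/ m)%:R).
Proof.
have hh : (h <= h.*2)%N by rewrite -addnn leq_addr.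
have E : ln h`!%:R = \sum_(1 <= m < h.*2.+1) mangoldt m * (h %/ m)%:R.
  rewrite ln_fact_mangoldt (@big_cat_nat _ _ _ h.+1 1 h.*2.+1) //=.
  rewrite [X in _ + X]big_nat_cond [X in _ + X]big1 ?addr0 // => m /andP[/andP[hm _] _].
  by rewrite divn_small // mulr0.
have := congr1 (fun n => ln (n%:R : R)) (bin_fact hh).
rewrite -addnn addnK addnn !natrM !lnM ?posrE ?mulr_gt0 ?ltr0n ?bin_gt0 ?fact_gt0 //.
rewrite E ln_fact_mangoldt => /(canRL (addrK _)) ->; rewrite -big_split -sumrB /=.
by apply: eq_bigr => m _; ring.
Qed.

Lemma central_binomial_le h : ('C(h.*2, h) <= 2 ^ h.*2)%N.
Proof.
have -> : 'C(h.*2, h) = 'C(#|'I_h.*2|, h) by rewrite card_ord.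
rewrite -card_draws -[X in (_ <= 2 ^ X)%N]card_ord -cardsT -card_powerset.
by apply/subset_leq_card/subsetP => A _; rewrite powersetE subsetT.
Qed.

Lemma central_binomial_ge h : (2 ^ h <= 'C(h.*2, h))%N.
Proof.
(* Pascal's rule splits the next central coefficient into two equal terms, each at least the current
   one. *)
elim: h => // h IH; rewrite doubleS binS expnS mul2n -addnn.
have -> : 'C(h.*2.+1, h) = 'C(h.*2.+1, h.+1).
  by rewrite -[in RHS]bin_sub ?ltnS -?addnn ?leq_addr // subSS addnK.
have le : (2 ^ h <= 'C(h.*2.+1, h.+1))%N by rewrite binS; apply: leq_trans IH (leq_addl _ _).
by rewrite leq_add.
Qed.

Lemma divn_double_ge h m : (2 * (h %/ m) <= h.*2 %/ m)%N.
Proof.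
case: m => [|m]; first by rewrite !divn0.
by rewrite leq_divRL // -mulnA mul2n leq_double leq_trunc_div.
Qed.

Lemma divn_double_le h m : (0 < m)%N -> (h.*2 %/ m <= (2 * (h %/ m)).+1)%N.
Proof.
move=> m0; rewrite -ltnS ltn_divLR // {1}(divn_eq h m) -addnn.
have := ltn_pmod h m0; nia.
Qed.

(** In [ln_central_binomial] the coefficient of [mangoldt m] is always 0 or 1, and it is 1 for h < m
    <= 2 h. The second fact gives this upper bound, the first one the lower bound
    [psi_double_ge]. *)
Lemma psi_double_le h : psi h.*2 - psi h <= h.*2%:R * ln 2.
Proof.
apply: le_trans (_ : ln 'C(h.*2, h)%:R <= _); last first.
  rewrite mulr_natl -lnXn // -natrX ler_ln ?posrE ?ltr0n ?expn_gt0 //.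
    by rewrite ler_nat central_binomial_le.
  by rewrite bin_gt0 -addnn leq_addr.
have hh : (h <= h.*2)%N by rewrite -addnn leq_addr.
rewrite ln_central_binomial /psi !(@big_cat_nat _ _ _ h.+1 1 h.*2.+1) //=.
rewrite addrAC subrr add0r ler_wpDl //.
  apply: sumr_ge0 => m _; rewrite mulr_ge0 ?mangoldt_ge0 // subr_ge0 -natrM ler_nat.
  exact: divn_double_ge.
apply: ler_sum_nat => m /andP[hm mh].
have -> : (h %/ m = 0)%N by rewrite divn_small.
rewrite mulr0 subr0 ler_peMr ?mangoldt_ge0 // ler1n divn_gt0 //.
exact: leq_ltn_trans hm.
Qed.

Lemma psi_double_ge h : h%:R * ln 2 <= psi h.*2.
Proof.
apply: le_trans (_ : ln 'C(h.*2, h)%:R <= _).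
  rewrite mulr_natl -lnXn // -natrX ler_ln ?posrE ?ltr0n ?expn_gt0 //.
    by rewrite ler_nat central_binomial_ge.
  by rewrite bin_gt0 -addnn leq_addr.
rewrite ln_central_binomial; apply: ler_sum_nat => m /andP[m0 _].
rewrite ler_piMr ?mangoldt_ge0 // lerBlDl -natrM natr1 ler_nat.
exact: divn_double_le.
Qed.

Lemma ln2_bounds : 1 / 2 <= ln 2 :> R /\ ln 2 <= 47 / 60 :> R.
Proof.
split.
  by have := @ln_succ_sub_ge 1 isT; rewrite ln1 subr0 mul1r.
(* With ln u <= u - 1 on each factor the total is 1/5 + 1/4 + 1/3 = 47/60. *)
have -> : (2 : R) = (6 / 5) * (5 / 4) * (4 / 3) by field.
have H (x y : R) : 0 < x -> x - 1 <= y -> ln x <= y.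
  by move=> x0; apply: le_trans (ln_le_subr1 x0).
have a : ln (6 / 5) <= 1 / 5 :> R by apply: H; lra.
have b : ln (5 / 4) <= 1 / 4 :> R by apply: H; lra.
have c : ln (4 / 3) <= 1 / 3 :> R by apply: H; lra.
rewrite (@lnM _ (6 / 5 * (5 / 4))) ?(@lnM _ (6 / 5)) ?posrE; lra.
Qed.

Lemma mangoldt_le_ln n : mangoldt n <= ln n%:R.
Proof.
rewrite /mangoldt; case: ifP => [/andP[n1 _]|_]; last exact: ln_nat_ge0.
have n0 : (0 < n)%N by apply: ltnW.
by rewrite ler_ln ?posrE ?ltr0n ?pdiv_gt0 // ler_nat pdiv_leq.
Qed.

(* Chebyshev: any constant below [2 * 9/10] would do for the sequel. *)
Lemma psi_le_eventually : exists X, forall N, (X <= N)%N -> psi N <= (8 / 5) * N%:R.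
Proof.
have [ln2l ln2u] := ln2_bounds.
have [C C0 lnC] := @ln_le_linear (1 / 120) ltac:(lra).
(* Induction by halving. The slope 19/12 is 2 (47/60 + 1/120), where 1/120 comes from bounding ln N
   linearly; the constant C lost at each halving is recovered because the last term drops by (C / ln
   2) ln 2. *)
have bound N : (0 < N)%N -> psi N <= (19 / 12) * N%:R + C + (C / ln 2) * ln N%:R.
  elim/ltn_ind: N => N IH N0; have [N1|N1] := leqP N 1.
    have -> : N = 1%N by apply/eqP; rewrite eqn_leq N1.
    rewrite /psi big_nat1 ln1 mulr0 addr0.
    have -> : mangoldt 1 = 0 by [].
    lra.
  pose h := N./2; have h0 : (0 < h)%N by rewrite half_gt0.
  have hN : h.*2%:R <= N%:R :> R by rewrite ler_nat -[leqRHS]odd_double_half leq_addl.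
  have psiN : psi N <= psi h.*2 + ln N%:R.
    have [oN|eN] := boolP (odd N).
      have E1 : N = h.*2.+1 by rewrite -[LHS]odd_double_half oN.
      by rewrite [in psi N]E1 [psi _.+1]/psi big_nat_recr //= lerD2l -E1 mangoldt_le_ln.
    have -> : h.*2 = N by rewrite -[RHS]odd_double_half (negbTE eN).
    by rewrite lerDl ln_nat_ge0.
  have lnh : ln h%:R <= ln N%:R - ln 2 :> R.
    rewrite lerBrDr -lnM ?posrE ?ltr0n // -natrM muln2.
    by rewrite ler_ln ?posrE ?ltr0n ?double_gt0.
  have hltN : (h < N)%N by rewrite /h -divn2 ltn_Pdiv.
  have psih := psi_double_le h; have IHh := IH h hltN h0.
  have lnN : ln N%:R <= 1 / 120 * N%:R + C by apply: lnC; rewrite ltr0n.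
  have q0 : 0 <= C / ln 2 by rewrite divr_ge0 //; lra.
  have lnh' := ler_wpM2l q0 lnh.
  have EC : C / ln 2 * ln 2 = C by rewrite divfK // gt_eqF //; lra.
  have l2 : h.*2%:R * ln 2 <= N%:R * (47 / 60) :> R.
    by apply: ler_pM => //; lra.
  have {}hN : 2 * h%:R <= N%:R :> R by rewrite -natrM mul2n.
  rewrite mulrBr EC in lnh'; lra.
have c20 : 0 <= C / ln 2 by rewrite divr_ge0 //; lra.
set c2 := C / ln 2 in bound c20.
(* The logarithmic and the constant terms are each made at most N / 120, and 19/12 + 2/120 = 8/5.
   The denominator 1 + c2 stays positive even if c2 = 0. *)
have [|D D0 lnD] := @ln_le_linear ((1 / 120) / (1 + c2)); first by rewrite divr_gt0 //; lra.
have [X HX] : exists X : nat, 120 * (C + c2 * D) <= X%:R.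
  by exists (Num.truncn (120 * (C + c2 * D))).+1; apply/ltW/truncnS_gt.
exists X.+1 => N XN; have N0 : (0 < N)%N by apply: leq_trans XN.
have := bound N N0; have := ler_wpM2l c20 (lnD N%:R _); rewrite ltr0n => /(_ N0).
have N0' : 0 <= N%:R :> R by rewrite ler0n.
have : X%:R <= N%:R :> R by rewrite ler_nat ltnW.
have : c2 * ((1 / 120) / (1 + c2) * N%:R) <= 1 / 120 * N%:R.
  rewrite mulrA ler_wpM2r // mulrA ler_pdivrMr; last lra.
  by rewrite mulrC ler_wpM2l //; lra.
rewrite mulrDr; lra.
Qed.

Lemma psi_le : exists2 K : R, 0 <= K & forall N, psi N <= K * N%:R.
Proof.
have [X HX] := psi_le_eventually.
have Xge : 0 <= psi X by exact: psi_ge0.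
exists (psi X + 8 / 5); first lra.
case=> [|N]; first by rewrite mulr0 /psi big_geq.
have [XN|NX] := leqP X N.+1.
  apply: le_trans (HX _ XN) _; rewrite ler_wpM2r ?ler0n //; lra.
apply: le_trans (psi_mono (ltnW NX)) _.
have : 1 <= N.+1%:R :> R by rewrite ler1n.
move: (N.+1%:R) => y y1; have := ler_wpM2l Xge y1; lra.
Qed.

Lemma psi_ge N : (N%:R - 1) / 4 <= psi N.
Proof.
have [ln2l _] := ln2_bounds.
have := odd_double_half N; set h := N./2 => E.
have hN : (h.*2 <= N)%N by rewrite -[leqRHS]E leq_addl.
apply: le_trans (psi_mono hN); apply: le_trans (psi_double_ge h).
have N1 : N%:R - 1 <= 2 * h%:R :> R.
  by rewrite lerBlDr -natrM natr1 ler_nat mul2n -[leqLHS]E -addn1 addnC leq_add2l leq_b1.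
have h0 : 0 <= h%:R :> R by rewrite ler0n.
have := ler_wpM2l h0 ln2l; lra.
Qed.

(** Compare N times the sum with ln N! = N ln N + O(N): in [ln_fact_mangoldt], replacing the integer
    part of N / m by N / m costs at most psi N, which is O(N). *)
Lemma mertens : exists2 K : R, 0 <= K & forall N, (0 < N)%N ->
  `| \sum_(1 <= m < N.+1) mangoldt m / m%:R - ln N%:R | <= K.
Proof.
have [K K0 HK] := psi_le; exists (K + 1); first lra.
move=> N N0; have N0' : 0 < N%:R :> R by rewrite ltr0n.
set S := \sum_(_ <= _ < _) _.
have up : ln N`!%:R <= N%:R * S.
  rewrite ln_fact_mangoldt mulr_sumr; apply: ler_sum_nat => m /andP[m0 _].
  rewrite mulrCA ler_wpM2l ?mangoldt_ge0 // ler_pdivlMr ?ltr0n // -natrM ler_nat.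
  exact: leq_trunc_div.
have lo : N%:R * S <= ln N`!%:R + psi N.
  rewrite ln_fact_mangoldt mulr_sumr /psi -big_split; apply: ler_sum_nat => m /andP[m0 _] /=.
  rewrite mulrCA -[X in _ <= _ + X]mulr1 -mulrDr ler_wpM2l ?mangoldt_ge0 // ler_pdivrMr ?ltr0n // natr1 -natrM ler_nat.
  by rewrite ltnW // -ltn_divLR.
have f1 := @ln_fact_ge N N0; have f2 := @ln_fact_le N N0; have KN := HK N.
have lnN : ln N%:R <= N%:R - 1 := ln_le_subr1 N0'.
rewrite ler_norml -(ler_pM2l N0') -[X in _ && X](ler_pM2l N0') !mulrBr mulrDr mulrN mulr1.
by apply/andP; split; lra.
Qed.

(** * Moebius inversion *)

Definition mobius (n : nat) : R :=
  if all (fun p => logn p n == 1%N) (primes n) then (-1) ^+ size (primes n) else 0.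

Lemma mobius_norm_le1 n : `|mobius n| <= 1.
Proof.
by rewrite /mobius; case: ifP => _; rewrite ?normr0 ?normrX ?normrN1 ?expr1n.
Qed.

Lemma mobius_mul_prime p d : prime p -> (0 < d)%N -> ~~ (p %| d)%N ->
  mobius (p * d) = - mobius d.
Proof.
move=> p_pr d0 pd.
have pNd : p \notin primes d by rewrite mem_primes !negb_and pd !orbT.
have P : perm_eq (primes (p * d)) (p :: primes d).
  apply: uniq_perm; rewrite ?primes_uniq //= ?pNd ?primes_uniq // => q.
  by rewrite primesM ?(prime_gt0 p_pr) // primes_prime // !inE.
rewrite /mobius (perm_all _ P) (perm_size P) /= exprS mulN1r.
have -> : logn p (p * d) = 1%N.
  by rewrite lognM ?(prime_gt0 p_pr) // logn_prime // eqxx (_ : logn p d = 0)%N // lognE (negbTE pd) !andbF.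
rewrite eqxx /= (@eq_in_all _ _ (fun q => logn q d == 1%N)); first by case: ifP; rewrite ?oppr0.
move=> q qd; rewrite lognM ?(prime_gt0 p_pr) // logn_prime //.
by have -> : (q == p) = false by apply: contraNF pNd => /eqP <-.
Qed.

Lemma mobius_mul_dvd p d : prime p -> (0 < d)%N -> (p %| d)%N -> mobius (p * d) = 0.
Proof.
move=> p_pr d0 pd; rewrite /mobius; case: ifP => // /allP/(_ p).
rewrite primesM ?(prime_gt0 p_pr) // primes_prime // inE eqxx => /(_ isT).
by rewrite lognM ?(prime_gt0 p_pr) // logn_prime // eqxx add1n eqSS -leqn0 leqNgt logn_gt0 mem_primes p_pr d0 pd.
Qed.

(** For n > 1 take the least prime divisor p. The map e -> p e pairs divisors of opposite sign:
    those prime to p with those divisible by p just once. Divisors containing p twice contribute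
    0. *)
Lemma sum_mobius_divisors n : (0 < n)%N ->
  \sum_(1 <= d < n.+1 | (d %| n)%N) mobius d = (n == 1%N)%:R.
Proof.
move=> n0; have [n1|] := ltnP 1 n; last first.
  case: n n0 => [|[|]] // _ _; by rewrite big_mkcond big_nat1 dvd1n /mobius.
rewrite (gtn_eqF n1).
pose p := pdiv n; have p_pr : prime p := pdiv_prime n1; have pn : (p %| n)%N := pdiv_dvd n.
have p0 := prime_gt0 p_pr.
rewrite (bigID (fun d => p %| d)%N) /=.
rewrite (eq_bigl (fun d => (p %| d) && (d %| n))%N); last by move=> d; rewrite andbC.
rewrite big_mkcondr /= (sum_multiples (fun d => if (d %| n)%N then mobius d else 0)) //.
set m := (n %/ p)%N.
have -> : \sum_(1 <= e < m.+1) (if (p * e %| n)%N then mobius (p * e) else 0) =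
    \sum_(1 <= e < m.+1 | (p * e %| n)%N && ~~ (p %| e)%N) - mobius e.
  rewrite [RHS]big_mkcond; apply: eq_big_nat => e /andP[e0 _].
  case: ifP => //= _; case: ifP => [pe|/negbFE pe]; first by rewrite mobius_mul_prime.
  by rewrite mobius_mul_dvd.
rewrite (big_nat_widen 1 m.+1 n.+1) ?ltnS ?leq_div //.
rewrite sumrN addrC; apply/eqP; rewrite subr_eq0; apply/eqP; rewrite big_nat_cond [RHS]big_nat_cond.
apply: eq_bigl => d; case: (boolP (1 <= d < n.+1)%N) => //= /andP[d0 _].
case: (boolP (p %| d)%N) => pd /=; rewrite ?andbF ?andbT //=.
have cpd : coprime p d by rewrite prime_coprime.
rewrite Gauss_dvd // pn /= ltnS leq_divRL // mulnC.
case: (boolP (d %| n)%N) => //= dn; apply/esym/dvdn_leq; first exact: ltnW.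
by rewrite Gauss_dvd // pn.
Qed.

Lemma sum_mobius_ln n : (0 < n)%N ->
  \sum_(1 <= d < n.+1 | (d %| n)%N) mobius d * ln (n %/ d)%:R = mangoldt n.
Proof.
move=> n0.
transitivity (\sum_(1 <= d < n.+1 | (d %| n)%N)
    \sum_(1 <= e < (n %/ d).+1 | (e %| n %/ d)%N) mobius d * mangoldt e).
  rewrite big_nat_cond [RHS]big_nat_cond; apply: eq_bigr => d /andP[/andP[d0 _] dn].
  by rewrite -mulr_sumr sum_mangoldt_divisors // divn_gt0 // dvdn_leq.
rewrite (sum_divisors_sym (fun d e => mobius d * mangoldt e)) //.
transitivity (\sum_(1 <= e < n.+1 | (e %| n)%N && (e == n)) mangoldt e); last first.
  by rewrite big_nat1_cond_eq n0 ltnSn dvdnn.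
rewrite [RHS]big_mkcondr [LHS]big_nat_cond [RHS]big_nat_cond.
apply: eq_bigr => e /andP[/andP[e0 _] en].
have ne0 : (0 < n %/ e)%N by rewrite divn_gt0 // dvdn_leq.
rewrite -mulr_suml (sum_mobius_divisors ne0).
rewrite (_ : (n %/ e == 1)%N = (e == n)); first by case: eqP; rewrite ?mul1r ?mul0r.
by rewrite -(eqn_pmul2r e0) divnK // mul1n eq_sym.
Qed.

(** Write x - ln d = (x - ln m) + ln (m / d); the first part survives only for m = 1, where ln m =
    0. *)
Lemma sum_mobius_ln_diff (x : R) m : (0 < m)%N ->
  \sum_(1 <= d < m.+1 | (d %| m)%N) mobius d * (x - ln d%:R) =
  (m == 1%N)%:R * x + mangoldt m.
Proof.
move=> m0.
transitivity (\sum_(1 <= d < m.+1 | (d %| m)%N)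
    (mobius d * (x - ln m%:R) + mobius d * ln (m %/ d)%:R)).
  rewrite big_nat_cond [RHS]big_nat_cond; apply: eq_bigr => d /andP[/andP[d0 _] dm].
  have md0 : (0 < m %/ d)%N by rewrite divn_gt0 // dvdn_leq.
  have -> : ln m%:R = ln (m %/ d)%:R + ln d%:R :> R.
    by rewrite -lnM ?posrE ?ltr0n // -natrM divnK.
  by ring.
rewrite big_split /= sum_mobius_ln // -mulr_suml sum_mobius_divisors //.
by case: eqP => [->|_]; rewrite ?ln1 ?subr0 ?mul0r.
Qed.

(** * Harmonic sums, averages of logarithms and the error terms of Selberg's formula *)

Definition harmonic (n : nat) : R := \sum_(1 <= m < n.+1) m%:R^-1.

Lemma harmonic_succ n : harmonic n.+1 = harmonic n + n.+1%:R^-1.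
Proof. by rewrite /harmonic big_nat_recr. Qed.

(** The sequence a n = H(n) - ln n decreases and b n = a n - 1 / n increases, so the supremum of b
    lies between them, at distance at most 1 / n from a n. The bounds 0 and 1 are b 1 and a 1. *)
Lemma euler_gamma : exists g : R, 0 <= g <= 1 /\
  forall n, (0 < n)%N -> 0 <= harmonic n - ln n%:R - g <= n%:R^-1.
Proof.
pose a n := harmonic n - ln n%:R; pose b n := a n - n%:R^-1.
have h1 : harmonic 1 = 1 by rewrite /harmonic big_nat1 invr1.
have a1 : a 1%N = 1 by rewrite /a h1 ln1 subr0.
have b1 : b 1%N = 0 by rewrite /b a1 invr1 subrr.
have aD n : (0 < n)%N -> a n.+1 <= a n.
  by move=> n0; have := ln_succ_sub_ge n0; rewrite /a harmonic_succ; move: (n.+1%:R^-1) => z; lra.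
have bI n : (0 < n)%N -> b n <= b n.+1.
  move=> n0; have := ln_succ_sub_le n0; rewrite /b /a harmonic_succ.
  by move: (n.+1%:R^-1) (n%:R^-1) => z w; lra.
have aM m k : (0 < m)%N -> a (k + m)%N <= a m.
  move=> m0; elim: k => // k IH; apply: le_trans IH; rewrite addSn aD //.
  by rewrite ltn_addl.
have bM m k : (0 < m)%N -> b m <= b (k + m)%N.
  move=> m0; elim: k => // k IH; apply: (le_trans IH); rewrite addSn bI //.
  by rewrite ltn_addl.
have ba m n : (0 < m)%N -> (0 < n)%N -> b m <= a n.
  move=> m0 n0; apply: le_trans (bM m n m0) _; apply: le_trans (aM n m n0).
  by rewrite /b addnC gerBl invr_ge0 ler0n.
pose E : classical_sets.set R := fun x => exists2 n, (0 < n)%N & x = b n.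
have Eb n : (0 < n)%N -> E (b n) by exists n.
have ubE n : (0 < n)%N -> classical_sets.ubound E (a n).
  by move=> n0 _ [m m0 ->]; exact: ba.
have supE : classical_sets.has_sup E by split; [exists (b 1%N); exact: Eb | exists (a 1%N); exact: ubE].
have le1 n : (0 < n)%N -> sup E <= a n by move=> n0; apply: ge_sup; [case: supE | exact: ubE].
have le2 n : (0 < n)%N -> b n <= sup E by move=> n0; apply: ub_le_sup; [case: supE | exact: Eb].
exists (sup E); split.
  by rewrite -{1}b1 -a1 le1 // le2.
move=> n n0; have := le1 n n0; have := le2 n n0; rewrite /b /a.
by move: (n%:R^-1) => z; lra.
Qed.

Lemma sum_ln_div_le N : (0 < N)%N -> \sum_(1 <= d < N.+1) (ln N%:R - ln d%:R) <= N%:R :> R.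
Proof.
move=> N0; rewrite sumrB -ln_fact big_const_nat iter_addr addr0 subn1 /= -[ln _ *+ N]mulr_natl.
by have := ln_fact_ge N0; lra.
Qed.

(* Passing from [N] to [N + 1] increases the sum by at most 3. *)
Lemma sum_ln_div_sqr_le N : (0 < N)%N ->
  \sum_(1 <= d < N.+1) (ln N%:R - ln d%:R) ^+ 2 <= 3 * N%:R :> R.
Proof.
case: N => // N _; elim: N => [|N IH]; first by rewrite big_nat1 ln1; lra.
rewrite big_nat_recr //= subrr expr0n addr0.
set D : R := ln N.+2%:R - ln N.+1%:R.
have D0 : 0 <= D by rewrite subr_ge0 ler_ln ?posrE ?ltr0n // ler_nat.
have N0 : 0 < N.+1%:R :> R by rewrite ltr0n.
have ND : N.+1%:R * D <= 1.
  by have := ln_succ_sub_le (ltn0Sn N); rewrite -(ler_pM2l N0) divff ?lt0r_neq0.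
have -> : \sum_(1 <= d < N.+2) (ln N.+2%:R - ln d%:R) ^+ 2 =
   \sum_(1 <= d < N.+2) ((ln N.+1%:R - ln d%:R) ^+ 2 + (2 * D * (ln N.+1%:R - ln d%:R) + D ^+ 2)) :> R.
  by apply: eq_bigr => d _; rewrite /D; ring.
rewrite !big_split /= -mulr_sumr big_const_nat iter_addr addr0 subn1 /= -[D ^+ 2 *+ _]mulr_natl.
have S1 := @sum_ln_div_le N.+1 isT.
have D2 : 2 * D * \sum_(1 <= d < N.+2) (ln N.+1%:R - ln d%:R) <= 2.
  by have := ler_wpM2l D0 S1; move: ND; rewrite [D * N.+1%:R]mulrC; lra.
have D1 : D <= 1.
  apply: le_trans ND; rewrite ler_peMl // ler1n //.
have D3 : N.+1%:R * D ^+ 2 <= 1.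
  by rewrite expr2 mulrA; apply: le_trans (ler_wpM2r D0 ND) _; rewrite mul1r.
rewrite [N.+2%:R]mulrS; lra.
Qed.

(** With M the integer part of X = N / d, the sum is ln M! - X H(M) + (1 + g) M. The constant 1 + g
    is chosen to cancel the linear terms left by Stirling's formula and by H(M), so that only O(1 +
    ln X) remains. *)
Lemma selberg_weight_bound (g : R) d N : 0 <= g <= 1 ->
  (forall n, (0 < n)%N -> 0 <= harmonic n - ln n%:R - g <= n%:R^-1) ->
  (0 < d <= N)%N ->
  `| \sum_(1 <= e < (N %/ d).+1) (psi (N %/ (d * e)) - N%:R / (d * e)%:R + (1 + g)) |
    <= 4 * (1 + (ln N%:R - ln d%:R)).
Proof.
move=> /andP[g0 g1] Hg /andP[d0 dN]; set M := (N %/ d)%N; set X : R := N%:R / d%:R.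
have N0 : (0 < N)%N by apply: leq_trans dN.
have M0 : (0 < M)%N by rewrite divn_gt0.
have -> : \sum_(1 <= e < M.+1) (psi (N %/ (d * e)) - N%:R / (d * e)%:R + (1 + g)) =
    ln M`!%:R - X * harmonic M + (1 + g) * M%:R.
  rewrite big_split /= sumrB big_const_nat iter_addr addr0 subn1 /= mulr_natr; congr (_ - _ + _).
    by rewrite ln_fact_psi; apply: eq_bigr => e _; rewrite divnMA.
  rewrite mulr_sumr; apply: eq_bigr => e _.
  by rewrite natrM invfM mulrA.
have d0' : 0 < d%:R :> R by rewrite ltr0n.
have M0' : 0 < M%:R :> R by rewrite ltr0n.
have MX : M%:R <= X by rewrite ler_pdivlMr // -natrM ler_nat leq_trunc_div.
have XM : X <= M%:R + 1.
  by rewrite ler_pdivrMr // natr1 -natrM ler_nat ltnW // -ltn_divLR.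
have lnX : ln N%:R - ln d%:R = ln X by rewrite ln_div // posrE ltr0n.
rewrite lnX; have lnMX : ln M%:R <= ln X by rewrite ler_ln ?posrE //; lra.
have lnM0 : 0 <= ln M%:R :> R by exact: ln_nat_ge0.
have /andP[e2l e2u] := Hg M M0.
move: e2l e2u; set e2 := harmonic M - ln M%:R - g => e2l e2u.
have -> : harmonic M = e2 + ln M%:R + g by rewrite /e2; ring.
have f1 := ln_fact_ge M0; have f2 := ln_fact_le M0.
have Xe2 : X * e2 <= 2.
  have Me : M%:R * e2 <= 1.
    by apply: le_trans (ler_wpM2l (ltW M0') e2u) _; rewrite divff ?lt0r_neq0.
  have M1 : 1 <= M%:R :> R by rewrite ler1n.
  have := ler_wpM2r e2l XM; have := ler_wpM2r e2l M1; lra.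
have Xe20 : 0 <= X * e2 by rewrite mulr_ge0 //; lra.
have c1 : 0 <= (X - M%:R) * (ln M%:R + g) by rewrite mulr_ge0 //; lra.
have c2 : (X - M%:R) * (ln M%:R + g) <= ln M%:R + g.
  rewrite ler_piMl //; lra.
by rewrite ler_norml; apply/andP; split; lra.
Qed.

(* The identity behind Selberg's formula (Tatuzawa--Iseki): weighting by
   [mobius d * ln (N / d)] recovers [ln N] at [1] plus the von Mangoldt function. *)
Lemma selberg : exists2 K : R, 0 <= K & forall N, (0 < N)%N ->
  `| psi N * ln N%:R + \sum_(1 <= m < N.+1) mangoldt m * psi (N %/ m)
     - 2 * N%:R * ln N%:R | <= K * N%:R.
Proof.
have [g [g01 Hg]] := euler_gamma; have [Km Km0 HKm] := mertens.
have [Kp Kp0 HKp] := psi_le; have /andP[g0 g1] := g01.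
exists (16 + Km + 2 + 2 * Kp) => [|N N0]; first lra.
pose T m := psi (N %/ m) - N%:R / m%:R + (1 + g).
have N0' : 0 < N%:R :> R by rewrite ltr0n.
have main : T 1%N * ln N%:R + \sum_(1 <= m < N.+1) mangoldt m * T m =
   \sum_(1 <= d < N.+1) \sum_(1 <= e < (N %/ d).+1) mobius d * (ln N%:R - ln d%:R) * T (d * e)%N.
  rewrite -(sum_divisors_swap (fun d e => mobius d * (ln N%:R - ln d%:R) * T (d * e)%N)).
  transitivity (\sum_(1 <= m < N.+1) ((m == 1%N)%:R * ln N%:R + mangoldt m) * T m).
    rewrite [RHS](eq_bigr (fun m => (if m == 1%N then ln N%:R * T m else 0) + mangoldt m * T m)).
      by rewrite big_split /= -big_mkcond /= big_nat1_eq ltnSn ltnS N0 mulrC.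
    by move=> m _; rewrite mulrDl; case: eqP; rewrite ?mul1r ?mul0r.
  apply: eq_big_nat => m /andP[m0 _]; rewrite -sum_mobius_ln_diff // mulr_suml.
  rewrite big_nat_cond [RHS]big_nat_cond; apply: eq_bigr => d /andP[_ dm].
  by rewrite mulnC divnK.
(* Here 16 = 4 + 4 * 3, from the sums of ln (N / d) and of its square. *)
have bound : `| T 1%N * ln N%:R + \sum_(1 <= m < N.+1) mangoldt m * T m | <= 16 * N%:R.
  rewrite main; apply: le_trans (ler_norm_sum _ _ _) _.
  apply: (@le_trans _ _ (\sum_(1 <= d < N.+1)
     (4 * (ln N%:R - ln d%:R) + 4 * (ln N%:R - ln d%:R) ^+ 2))).
    apply: ler_sum_nat => d /andP[d0 dN].
    have L0 : 0 <= ln N%:R - ln d%:R :> R.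
      by rewrite subr_ge0 ler_ln ?posrE ?ltr0n // ler_nat.
    have W := @selberg_weight_bound g d N g01 Hg; rewrite d0 -ltnS dN in W.
    rewrite -mulr_sumr !normrM (ger0_norm L0).
    have m1 := mobius_norm_le1 d.
    have := ler_wpM2l L0 (W isT).
    have := ler_wpM2r (mulr_ge0 L0 (normr_ge0 (\sum_(1 <= e < (N %/ d).+1) T (d * e)%N))) m1.
    by rewrite mul1r mulrA expr2 /T; lra.
  rewrite big_split /= -!mulr_sumr.
  by have := @sum_ln_div_le N N0; have := @sum_ln_div_sqr_le N N0; lra.
(* Expanding [T] produces one N ln N directly and a second one through [mertens]; the terms with 1 +
   g are O(N). *)
have E : T 1%N * ln N%:R + \sum_(1 <= m < N.+1) mangoldt m * T m =
  psi N * ln N%:R + \sum_(1 <= m < N.+1) mangoldt m * psi (N %/ m)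
   - N%:R * ln N%:R + (1 + g) * ln N%:R - N%:R * \sum_(1 <= m < N.+1) mangoldt m / m%:R
   + (1 + g) * psi N.
  rewrite [X in _ = _ + (1 + g) * X]/psi !mulr_sumr -!addrA.
  rewrite (eq_bigr (fun m => mangoldt m * psi (N %/ m) + (- (N%:R * (mangoldt m / m%:R)) + (1 + g) * mangoldt m))); last first.
    by move=> m _; rewrite /T; ring.
  by rewrite !big_split /= sumrN /T divn1 divr1; ring.
have M := HKm N N0; have P := HKp N; have P0 := psi_ge0 N.
have lnN : ln N%:R <= N%:R - 1 := ln_le_subr1 N0'.
have lnN0 := ln_nat_ge0 N.
move: bound M; rewrite E !ler_norml => /andP[b1 b2] /andP[M1 M2].
have := ler_wpM2l (ltW N0') M1; have := ler_wpM2l (ltW N0') M2.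
have := ler_wpM2r lnN0 g1; have := ler_wpM2r lnN0 g0.
have := ler_wpM2r P0 g1; have := ler_wpM2r P0 g0.
by move=> *; apply/andP; split; lra.
Qed.

(** * Primes in short intervals *)

Lemma ex_nat_ge (x : R) : exists n : nat, x <= n%:R.
Proof. by exists (Num.truncn x).+1; apply/ltW/truncnS_gt. Qed.

Lemma ex_ln_ge (c : R) : exists B : nat, forall n, (B <= n)%N -> c <= ln n%:R.
Proof.
have [B HB] := ex_nat_ge (expR c); exists B => n Bn.
have cn : expR c <= n%:R by apply: le_trans HB _; rewrite ler_nat.
by rewrite -(expRK c) ler_ln ?posrE ?expR_gt0 //; apply: lt_le_trans cn; exact: expR_gt0.
Qed.

Lemma ratio_bounds (a m : nat) : (0 < m)%N -> (a %/ m)%:R <= a%:R / m%:R :> R /\ a%:R / m%:R <= (a %/ m)%:R + 1 :> R.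
Proof.
move=> m0; have m0' : 0 < m%:R :> R by rewrite ltr0n.
rewrite ler_pdivlMr // ler_pdivrMr // natr1 -!natrM !ler_nat leq_trunc_div; split=> //.
by rewrite ltnW // -ltn_divLR.
Qed.

(** Subtract Selberg's formula at a from that at b. The sum over m does not decrease, so (psi b -
    psi a) ln a <= 2 (b - a) ln a + O(a); dividing by ln a makes the error at most kappa a for large
    a. *)
Lemma psi_short_le (Q kappa : R) : 1 <= Q -> 0 < kappa ->
  exists B : nat, forall a b, (B <= a)%N -> (a <= b)%N -> b%:R <= Q * a%:R ->
    psi b - psi a <= 2 * (b%:R - a%:R) + kappa * a%:R.
Proof.
move=> Q1 k0; have [K K0 HK] := selberg.
have [B HB] := ex_ln_ge ((2 * Q ^+ 2 + K * (Q + 1)) / kappa).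
exists B.+2 => a b Ba ab bQ.
have a0 : (0 < a)%N by apply: leq_trans Ba.
have b0 : (0 < b)%N by apply: leq_trans ab.
have a0' : 0 < a%:R :> R by rewrite ltr0n.
have b0' : 0 < b%:R :> R by rewrite ltr0n.
have ab' : a%:R <= b%:R :> R by rewrite ler_nat.
have lna : 0 < ln a%:R :> R by rewrite ln_gt0 // ltr1n; apply: leq_trans Ba.
have lnab : ln a%:R <= ln b%:R :> R by rewrite ler_ln ?posrE.
have S : \sum_(1 <= m < a.+1) mangoldt m * psi (a %/ m) <= \sum_(1 <= m < b.+1) mangoldt m * psi (b %/ m).
  rewrite [leRHS](@big_cat_nat _ _ _ a.+1 1 b.+1) //= ler_wpDr //.
    by apply: sumr_ge0 => m _; rewrite mulr_ge0 ?mangoldt_ge0 ?psi_ge0.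
  by apply: ler_sum => m _; rewrite ler_wpM2l ?mangoldt_ge0 // psi_mono // leq_div2r.
move: (HK a a0) (HK b b0); rewrite !ler_norml => /andP[ha1 ha2] /andP[hb1 hb2].
have lnba : b%:R * (ln b%:R - ln a%:R) <= Q ^+ 2 * a%:R.
  have H : ln b%:R - ln a%:R <= Q :> R.
    apply: le_trans (ln_diff_le a0' b0') _; rewrite ler_pdivrMr //; lra.
  apply: le_trans (ler_wpM2l (ltW b0') H) _.
  by have := ler_wpM2l (le_trans ler01 Q1) bQ; lra.
have psib : 0 <= psi b * (ln b%:R - ln a%:R) by rewrite mulr_ge0 ?psi_ge0 // subr_ge0.
have Kb := ler_wpM2l K0 bQ.
have lnB : (2 * Q ^+ 2 + K * (Q + 1)) * a%:R <= kappa * a%:R * ln a%:R.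
  rewrite [leRHS]mulrAC ler_wpM2r ?(ltW a0') // [kappa * _]mulrC -ler_pdivrMr //.
  by apply: HB; apply: ltnW; apply: ltnW.
rewrite -(ler_pM2r lna); lra.
Qed.

(** The form applied to s = x / m and t = y / m, with a and b their integer parts. Rounding costs at
    most 2, which half of kappa s absorbs once kappa s >= 4. *)
Lemma psi_interval_le (Q kappa : R) : 1 <= Q -> 0 < kappa ->
  exists B : nat, forall (a b : nat) (s t : R), a%:R <= s -> s <= a%:R + 1 -> b%:R <= t ->
    s <= t -> B%:R <= s -> t <= Q * s ->
    psi b - psi a <= 2 * (t - s) + kappa * s.
Proof.
move=> Q1 k0; have [B HB] := @psi_short_le (2 * Q) (kappa / 2) ltac:(lra) ltac:(lra).
have [B2 HB2] := ex_nat_ge (4 / kappa).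
exists (B + B2 + 2)%N => a b s t as1 as2 bt st Bs tQ; rewrite !natrD in Bs.
have B0 : 0 <= B%:R :> R by rewrite ler0n.
have B20 : 0 <= B2%:R :> R by rewrite ler0n.
have ks : 4 <= kappa * s.
  have : kappa * (4 / kappa) <= kappa * s by rewrite ler_pM2l //; lra.
  by rewrite mulrCA divff ?mulr1 ?gt_eqF.
have [ab|ba] := leqP a b; last first.
  by have := psi_mono (ltnW ba); lra.
have Ba : (B <= a)%N by rewrite -(ler_nat R); lra.
have a1 : 1 <= a%:R :> R by lra.
have bQ : b%:R <= 2 * Q * a%:R.
  have := ler_wpM2l (le_trans ler01 Q1) a1.
  have := ler_wpM2l (le_trans ler01 Q1) as2; lra.
by have := HB a b Ba ab bQ; have := ler_wpM2l (ltW k0) as1; lra.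
Qed.

(* A lower bound for the sum in Selberg's formula over a short gap [(x, y]] of the
   primes; the terms with [m > x / B] contribute only [O(x)]. *)
Lemma selberg_gap (Q kappa : R) (B : nat) : 1 <= Q -> (0 < B)%N ->
  exists K : R, forall x y : nat, (0 < x)%N -> (x <= y)%N -> y%:R <= Q * x%:R ->
    psi y - psi x < kappa * x%:R ->
    2 * (y%:R - x%:R) * ln x%:R - kappa * x%:R * ln x%:R - K * x%:R <=
    \sum_(1 <= m < (x %/ B).+1) mangoldt m * (psi (y %/ m) - psi (x %/ m)).
Proof.
move=> Q1 B0; have [K K0 HK] := selberg; have [Kp Kp0 HKp] := psi_le.
exists (K * (Q + 1) + Kp * Q * Q + Kp * Q * (Kp * (Q * B%:R))) => x y x0 xy yQ gap.
have y0 : (0 < y)%N by apply: leq_trans xy.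
have x0' : 0 < x%:R :> R by rewrite ltr0n.
have y0' : 0 < y%:R :> R by rewrite ltr0n.
have xy' : x%:R <= y%:R :> R by rewrite ler_nat.
have lnx : 0 <= ln x%:R :> R by exact: ln_nat_ge0.
have lnxy : ln x%:R <= ln y%:R :> R by rewrite ler_ln ?posrE.
set L := (x %/ B)%N; have Lx : (L <= x)%N by exact: leq_div.
have Sx : \sum_(1 <= m < L.+1) mangoldt m * psi (x %/ m) <= \sum_(1 <= m < x.+1) mangoldt m * psi (x %/ m).
  rewrite [leRHS](@big_cat_nat _ _ _ L.+1 1 x.+1) //= lerDl.
  by apply: sumr_ge0 => m _; rewrite mulr_ge0 ?mangoldt_ge0 ?psi_ge0.
have Sy : \sum_(1 <= m < y.+1) mangoldt m * psi (y %/ m) <=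
    \sum_(1 <= m < L.+1) mangoldt m * psi (y %/ m) + psi y * psi (y %/ L.+1).
  rewrite [leLHS](@big_cat_nat _ _ _ L.+1 1 y.+1) //=; last by rewrite ltnS (leq_trans Lx).
  rewrite lerD2l [psi y]/psi [leRHS]mulr_suml.
  rewrite [leRHS](@big_cat_nat _ _ _ L.+1 1 y.+1) //=; last by rewrite ltnS (leq_trans Lx).
  rewrite ler_wpDl //; first by apply: sumr_ge0 => m _; rewrite mulr_ge0 ?mangoldt_ge0 ?psi_ge0.
  apply: ler_sum_nat => m /andP[Lm _]; rewrite ler_wpM2l ?mangoldt_ge0 // psi_mono //.
  exact: leq_div2l.
(* For m > x / B the quotient y / m is at most Q B, so all these terms together are at most a
   constant times psi y. *)
have yL : (y %/ L.+1)%:R <= Q * B%:R :> R.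
  have [h _] := @ratio_bounds y L.+1 isT; apply: (le_trans h).
  rewrite ler_pdivrMr ?ltr0n //; apply: (le_trans yQ).
  rewrite -mulrA ler_wpM2l ?(le_trans ler01 Q1) // -natrM ler_nat ltnW // mulnC -ltn_divLR //.
have psiyL : psi y * psi (y %/ L.+1) <= Kp * Q * (Kp * (Q * B%:R)) * x%:R.
  have h1 : psi y <= Kp * Q * x%:R.
    by apply: le_trans (HKp y) _; rewrite -mulrA ler_wpM2l.
  have h2 : psi (y %/ L.+1) <= Kp * (Q * B%:R).
    by apply: le_trans (HKp _) _; rewrite ler_wpM2l.
  by rewrite mulrAC ler_pM ?psi_ge0.
have psiy : psi y * (ln y%:R - ln x%:R) <= Kp * Q * Q * x%:R.
  have h1 : psi y <= Kp * Q * x%:R.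
    by apply: le_trans (HKp y) _; rewrite -mulrA ler_wpM2l.
  have h2 : ln y%:R - ln x%:R <= Q.
    apply: le_trans (ln_diff_le x0' y0') _; rewrite ler_pdivrMr //; lra.
  by rewrite mulrAC ler_pM ?psi_ge0 ?subr_ge0.
have gap' := ler_wpM2r lnx (ltW gap).
have ylny : y%:R * ln x%:R <= y%:R * ln y%:R :> R by rewrite ler_wpM2l // ltW.
have Ky := ler_wpM2l K0 yQ.
move: (HK x x0) (HK y y0); rewrite !ler_norml => /andP[ha1 ha2] /andP[hb1 hb2].
rewrite (eq_bigr (fun m => mangoldt m * psi (y %/ m) - mangoldt m * psi (x %/ m))); last first.
  by move=> m _; rewrite mulrBr.
rewrite sumrB.
move: Sx Sy ha1 ha2 hb1 hb2; set s1 := \sum_(_ <= _ < L.+1) _; set s2 := \sum_(_ <= _ < x.+1) _.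
set s3 := \sum_(_ <= _ < y.+1) _; set s4 := \sum_(_ <= _ < L.+1) _.
move: s1 s2 s3 s4 => s1 s2 s3 s4 *.
lra.
Qed.

(* By [psi_interval_le] the mass of [psi] on [(x / m, y / m]] is at most about
   [2 * (y - x) / m]; [m] is full when this bound is nearly attained. *)
Definition full (k : R) (x y m : nat) : bool :=
  2 * (y%:R - x%:R) - k * x%:R <= (psi (y %/ m) - psi (x %/ m)) * m%:R.

(** Each term of [selberg_gap] is at most U Lambda(m) / m, with U = 2 (y - x) + kappa x, and an m
    that is not full loses a further (kappa + k) x Lambda(m) / m. By [mertens] the total exceeds the
    lower bound of [selberg_gap] by at most 2 kappa x ln x + O(x) before these losses; the O(x) is
    put under one more kappa x ln x. *)
Lemma not_full_weight_le (Q kappa k : R) : 1 <= Q -> 0 < kappa -> 0 < k ->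
  exists B0 : nat, forall B, (B0 < B)%N -> exists X : nat,
    forall x y : nat, (X <= x)%N -> (x <= y)%N -> y%:R <= Q * x%:R ->
    psi y - psi x < kappa * x%:R ->
    \sum_(1 <= m < (x %/ B).+1 | ~~ full k x y m) mangoldt m / m%:R <= 3 * kappa / k * ln x%:R.
Proof.
move=> Q1 kap0 k0; have [Bi HBi] := @psi_interval_le Q kappa Q1 kap0.
exists Bi => B BiB; have B0 : (0 < B)%N by apply: leq_trans BiB.
have [K HK] := @selberg_gap Q kappa B Q1 B0; have [Km Km0 HKm] := mertens.
have [X HX] := ex_ln_ge (((2 * Q + kappa) * Km + K) / kappa).
exists (X + B)%N => x y Xx xy yQ gap.
have XlX : (X <= x)%N by apply: leq_trans Xx; exact: leq_addr.
have Bx : (B <= x)%N by apply: leq_trans Xx; exact: leq_addl.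
have x0 : (0 < x)%N by apply: leq_trans Bx.
have x0' : 0 < x%:R :> R by rewrite ltr0n.
have xy' : x%:R <= y%:R :> R by rewrite ler_nat.
set L := (x %/ B)%N; have L0 : (0 < L)%N by rewrite divn_gt0.
set U : R := 2 * (y%:R - x%:R) + kappa * x%:R.
have U0 : 0 <= U by rewrite /U addr_ge0 // mulr_ge0 ?(ltW kap0) ?(ltW x0') // subr_ge0.
have term m : (0 < m < L.+1)%N -> mangoldt m * (psi (y %/ m) - psi (x %/ m)) <=
    U * (mangoldt m / m%:R) - (kappa + k) * x%:R * (if ~~ full k x y m then mangoldt m / m%:R else 0).
  move=> /andP[m0 mL]; have m0' : 0 < m%:R :> R by rewrite ltr0n.
  have up : (psi (y %/ m) - psi (x %/ m)) * m%:R <= U.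
    have [hx1 hx2] := ratio_bounds x m0; have [hy1 _] := ratio_bounds y m0.
    have st : x%:R / m%:R <= y%:R / m%:R :> R by rewrite ler_pM2r ?invr_gt0.
    have Bs : Bi%:R <= x%:R / m%:R :> R.
      rewrite ler_pdivlMr // -natrM ler_nat; apply: leq_trans (leq_trunc_div x B).
      by rewrite mulnC leq_mul // ltnW.
    have tQ : y%:R / m%:R <= Q * (x%:R / m%:R) by rewrite mulrA ler_pM2r ?invr_gt0.
    have := HBi _ _ _ _ hx1 hx2 hy1 st Bs tQ.
    rewrite -(ler_pM2r m0') => /le_trans; apply.
    rewrite /U !mulrDl mulrBr mulrBl !mulrA !divfK ?lt0r_neq0 //; lra.
  have Lm : 0 <= mangoldt m / m%:R by rewrite divr_ge0 ?mangoldt_ge0 // ltW.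
  have -> : mangoldt m * (psi (y %/ m) - psi (x %/ m)) =
      (mangoldt m / m%:R) * ((psi (y %/ m) - psi (x %/ m)) * m%:R).
    by field; rewrite lt0r_neq0.
  rewrite /full -ltNge; case: ltP => H.
    by have := ler_wpM2l Lm (ltW H); rewrite /U; lra.
  by have := ler_wpM2l Lm up; lra.
have := HK x y x0 xy yQ gap; rewrite -/L => low.
have {term} := le_trans low (ler_sum_nat term).
rewrite sumrB -!mulr_sumr -big_mkcond /=.
set Sl := \sum_(1 <= i < L.+1) (mangoldt i / i%:R).
set Sb := \sum_(1 <= i < L.+1 | ~~ full k x y i) (mangoldt i / i%:R) => H.
have Slle : Sl <= ln x%:R + Km.
  have := HKm L L0; rewrite ler_norml => /andP[_].
  have : ln L%:R <= ln x%:R :> R by rewrite ler_ln ?posrE ?ltr0n // ler_nat leq_div.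
  rewrite /Sl; lra.
have USl := ler_wpM2l U0 Slle.
have lnx : (2 * Q + kappa) * Km + K <= kappa * ln x%:R.
  by rewrite [kappa * _]mulrC -ler_pdivrMr //; exact: HX.
have UK : U * Km <= (2 * Q + kappa) * Km * x%:R.
  rewrite [leRHS]mulrAC ler_wpM2r //; rewrite /U; lra.
have lnxx := ler_wpM2r (ltW x0') lnx.
have Sb0 : 0 <= Sb.
  by apply: sumr_ge0 => m _; rewrite divr_ge0 ?mangoldt_ge0.
have key : x%:R * (k * Sb) <= x%:R * (3 * kappa * ln x%:R).
  have : 0 <= x%:R * (kappa * Sb) by rewrite !mulr_ge0 ?(ltW x0') ?(ltW kap0).
  by move: H USl UK lnxx; rewrite /U; lra.
by move: key; rewrite ler_pM2l // => key; rewrite [leRHS]mulrAC ler_pdivlMr // mulrC.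
Qed.

(** * Shrinking the intervals on which psi grows linearly *)

Definition psi_grows (c : R) : Prop := exists2 delta : R, 0 < delta &
  exists X : nat, forall x y : nat, (X <= x)%N -> c * x%:R <= y%:R ->
    delta * x%:R <= psi y - psi x.

Definition next_nat (r : R) : nat := (Num.truncn r).+1.

Lemma next_nat_bounds r : 0 <= r -> r < (next_nat r)%:R <= r + 1.
Proof.
move=> r0; rewrite truncnS_gt /next_nat -natr1 lerD2r.
by rewrite truncn_le.
Qed.

(* There are about [ln x / ln W] disjoint windows [(z, W z]] below [x]; each one
   containing an interval [(t, c t]] without points of [P] contributes at least
   [delta / (c + 1)] to the sum. *)
Lemma ex_full_window (c : R) (W : nat) : 1 < c -> psi_grows c -> (1 < W)%N ->
  exists2 rho : R, 0 < rho & forall X1 B, (0 < X1)%N -> (0 < B)%N ->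
  exists X : nat, forall (x : nat) (P : pred nat), (X <= x)%N ->
    \sum_(1 <= m < (x %/ B).+1 | ~~ P m) mangoldt m / m%:R <= rho * ln x%:R ->
    exists z, [/\ (X1 <= z)%N, (W * z <= x %/ B)%N &
      forall t, (z <= t)%N -> (next_nat (c * t%:R) <= W * z)%N ->
        exists2 n, (t < n <= next_nat (c * t%:R))%N & P n].
Proof.
move=> c1 [delta delta0 [X0 HX0]] W1.
have lnW : 0 < ln W%:R :> R by rewrite ln_gt0 // ltr1n.
have W0' : 0 < W%:R :> R by rewrite ltr0n ltnW.
(* Half of what about ln x / ln W windows would contribute, each giving delta / (c + 1). *)
exists (delta / (2 * (c + 1) * ln W%:R)).
  by rewrite divr_gt0 // !mulr_gt0 //; lra.
move=> X1 B X10 B0; pose Z := maxn X1 X0.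
have Z0 : (0 < Z)%N by rewrite leq_max X10.
have [X HX] := ex_ln_ge (2 * (ln W%:R + ln (B * Z)%:R) + 1 : R).
exists (X + B * Z)%N => x P Xx weight.
set L := (x %/ B)%N in weight *.
have BZx : (B * Z <= x)%N by apply: leq_trans Xx; exact: leq_addl.
have BZ0 : (0 < B * Z)%N by rewrite muln_gt0 B0.
have x0 : (0 < x)%N by apply: leq_trans BZx.
pose J := trunc_log W (L %/ Z).
have LZ0 : (0 < L %/ Z)%N by rewrite -divnMA divn_gt0.
have WJ : (W ^ J * Z <= L)%N by rewrite -leq_divRL //; exact: trunc_logP.
apply: contrapT => no.
have step j : (j <= J)%N ->
    j%:R * (delta / (c + 1)) <= \sum_(1 <= m < (W ^ j * Z).+1 | ~~ P m) mangoldt m / m%:R.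
  elim: j => [|j IH] jJ.
    by rewrite mul0r sumr_ge0 // => m _; rewrite divr_ge0 ?mangoldt_ge0.
  set z := (W ^ j * Z)%N in IH *.
  have Ez : (W ^ j.+1 * Z = W * z)%N by rewrite expnS mulnA.
  have Wz : (W * z <= L)%N.
    by rewrite -Ez; apply: leq_trans WJ; rewrite leq_mul2r leq_pexp2l ?orbT // ltnW.
  have zZ : (Z <= z)%N by rewrite leq_pmull // expn_gt0 ltnW.
  have z0 : (0 < z)%N by apply: leq_trans zZ.
  have [t [zt tW bad]] : exists t, [/\ (z <= t)%N, (next_nat (c * t%:R) <= W * z)%N &
      forall n, (t < n <= next_nat (c * t%:R))%N -> ~~ P n].
    apply: contrapT => H; apply: no; exists z; split=> //.
      by apply: leq_trans zZ; rewrite leq_max leqnn.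
    move=> t zt tW; apply: contrapT => H2; apply: H; exists t; split=> // n tn.
    by apply/negP => Pn; apply: H2; exists n.
  have t0 : (0 < t)%N by apply: leq_trans zt.
  have t0' : 0 < t%:R :> R by rewrite ltr0n.
  have t1 : 1 <= t%:R :> R by rewrite ler1n.
  have ct0 : 0 <= c * t%:R by rewrite mulr_ge0 ?(ltW t0') //; lra.
  have /andP[u1 u2] := next_nat_bounds ct0.
  set u := next_nat (c * t%:R) in tW bad u1 u2 *.
  have tu : (t <= u)%N.
    rewrite -(ler_nat R); apply: le_trans (ltW u1); rewrite ler_peMl //; lra.
  have u0' : 0 < u%:R :> R by rewrite ltr0n; apply: leq_trans tu.
  have X0t : (X0 <= t)%N.
    by apply: leq_trans zt; apply: leq_trans zZ; rewrite leq_max leqnn orbT.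
  rewrite Ez (@big_cat_nat _ _ _ z.+1 1 (W * z).+1) ?ltnS ?leq_pmull //=; last exact: ltnW.
  rewrite -natr1 mulrDl mul1r; apply: lerD; first by apply: IH; exact: ltnW.
  rewrite (@big_cat_nat _ _ _ t.+1 z.+1 (W * z).+1) //=; last first.
    by rewrite ltnS; apply: leq_trans tW.
  rewrite (@big_cat_nat _ _ _ u.+1 t.+1 (W * z).+1) //=.
  have nonneg a b : 0 <= \sum_(a <= m < b | ~~ P m) mangoldt m / m%:R.
    by apply: sumr_ge0 => m _; rewrite divr_ge0 ?mangoldt_ge0.
  apply: ler_wpDl => //; apply: ler_wpDr => //.
  (* Every weight 1 / m is at least 1 / u, while psi u - psi t >= delta t and u <= (c + 1) t. *)
  apply: (@le_trans _ _ (\sum_(t.+1 <= m < u.+1) mangoldt m / u%:R)); last first.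
    rewrite [leRHS]big_mkcond; apply: ler_sum_nat => m /andP[tm mu].
    rewrite bad ?tm // ler_wpM2l ?mangoldt_ge0 // lef_pV2 ?posrE ?ltr0n ?ler_nat //.
    exact: leq_ltn_trans tm.
  rewrite -mulr_suml.
  have -> : \sum_(t.+1 <= m < u.+1) mangoldt m = psi u - psi t.
    by rewrite /psi [in X in X - _](@big_cat_nat _ _ _ t.+1 1 u.+1) //= addrAC subrr add0r.
  rewrite ler_pdivlMr //; apply: le_trans (HX0 t u X0t (ltW u1)).
  rewrite mulrAC ler_pdivrMr; last lra.
  by rewrite -mulrA ler_pM2l //; lra.
have {step} H := le_trans (step J (leqnn J)) _.
have {}H : J%:R * (delta / (c + 1)) <= delta / (2 * (c + 1) * ln W%:R) * ln x%:R.
  apply: H; apply: le_trans weight.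
  rewrite [leRHS](@big_cat_nat _ _ _ (W ^ J * Z).+1 1 L.+1) //= lerDl.
  by apply: sumr_ge0 => m _; rewrite divr_ge0 ?mangoldt_ge0.
(* The J windows would use at most half of ln x, but the maximality of J gives ln x <= (J + 1) ln W
   + O(1); for large x these are incompatible. *)
have J2 : 2 * (J%:R * ln W%:R) <= ln x%:R :> R.
  have d0 : 0 < delta / (c + 1) by rewrite divr_gt0 //; lra.
  rewrite -(ler_pM2r d0).
  have -> : ln x%:R * (delta / (c + 1)) = (2 * ln W%:R) * (delta / (2 * (c + 1) * ln W%:R) * ln x%:R).
    by field; rewrite !lt0r_neq0 //; lra.
  have := ler_wpM2l (mulr_ge0 (ler0n R 2) (ltW lnW)) H; lra.
have xW : ln x%:R <= (J%:R + 1) * ln W%:R + ln (B * Z)%:R :> R.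
  have : (x < W ^ J.+1 * (B * Z))%N.
    rewrite -ltn_divLR // divnMA; exact: trunc_log_ltn.
  move=> /ltnW; rewrite -(ler_nat R) natrM natrX => h.
  have WJ0 : 0 < W%:R ^+ J.+1 :> R by apply: exprn_gt0.
  have BZ0' : 0 < (B * Z)%:R :> R by rewrite ltr0n.
  rewrite natr1 mulr_natl -lnXn // -lnM ?posrE //.
  by rewrite ler_ln ?posrE ?(mulr_gt0 WJ0 BZ0') ?ltr0n.
have XlX : (X <= x)%N by apply: leq_trans Xx; exact: leq_addr.
have := HX x XlX; lra.
Qed.

(* A full [n] forces the almost maximal density 2 on [(x / n, y / n]]; chaining such
   intervals, whose consecutive ratios are at most about [c], would make the density of
   the primes in [(0, x / z]] exceed 8/5, against Chebyshev's bound. *)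
Lemma no_full_window (c : R) : 1 < c ->
  exists (k : R) (W B X : nat), [/\ 0 < k, (1 < W)%N, (0 < B)%N, (0 < X)%N &
    forall x y z : nat, (X <= z)%N -> (B * (W * z) <= x)%N ->
      (1 + 9 / 10 * (c - 1)) * x%:R <= y%:R -> y%:R <= (c + 1) * x%:R ->
      ~ (forall t, (z <= t)%N -> (next_nat (c * t%:R) <= W * z)%N ->
          exists2 n, (t < n <= next_nat (c * t%:R))%N & full k x y n)].
Proof.
(* The chain moves from m to some n > (1 + b) m, which bounds each step from below; k and kappa are
   small against b so that the errors of one step stay below its gain. *)
move=> c1; pose b := (c - 1) / (100 * c); pose k := b / 10; pose kappa := k / (2 * c).
have b0 : 0 < b by rewrite /b divr_gt0 //; lra.
have bc : b * c = (c - 1) / 100 by rewrite /b; field; rewrite gt_eqF //; lra.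
have k0 : 0 < k by rewrite /k divr_gt0.
have kap0 : 0 < kappa by rewrite /kappa divr_gt0 //; lra.
have kapc : kappa * (2 * c) = k by rewrite /kappa divfK // gt_eqF //; lra.
have [W HW] := ex_nat_ge (200 * c).
have [Bi HBi] := @psi_interval_le (c + 1) kappa ltac:(lra) kap0.
have [Xc HXc] := psi_le_eventually.
have [X HX] := ex_nat_ge ((c + 1) / b).
have W1 : (1 < W)%N by rewrite -(ltr_nat R); lra.
exists k, W, (Bi + Xc).+1, X.+1; split=> // x y z Xz Bx yl yu win.
have z0 : (0 < z)%N by apply: leq_trans Xz.
have z0' : 0 < z%:R :> R by rewrite ltr0n.
have x0 : (0 < x)%N by apply: leq_trans Bx; rewrite !muln_gt0 z0 (ltnW W1).
have x0' : 0 < x%:R :> R by rewrite ltr0n.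
pose P m := psi (x %/ m).
have bz m : (z <= m)%N -> c + 1 <= b * m%:R.
  move=> zm; rewrite mulrC -ler_pdivrMr //; apply: (le_trans HX); rewrite ler_nat.
  by apply: leq_trans zm; apply: ltnW.
have step m n : (z <= m)%N -> (n <= W * z)%N -> (1 + b) * m%:R < n%:R ->
    n%:R <= 2 * c * m%:R -> n%:R - m%:R <= 102 / 100 * (c - 1) * m%:R -> full k x y n ->
    17 / 10 * (x%:R / m%:R - x%:R / n%:R) <= P m - P n.
  move=> zm nW nm1 nm2 nm3 fn.
  have m0 : (0 < m)%N by apply: leq_trans zm.
  have m0' : 0 < m%:R :> R by rewrite ltr0n.
  have bm0 : 0 < b * m%:R by rewrite mulr_gt0.
  have n0' : 0 < n%:R :> R by lra.
  have n0 : (0 < n)%N by rewrite -(ltr_nat R).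
  have mn : (m <= n)%N by rewrite -(ler_nat R); lra.
  have mn' : m%:R <= n%:R :> R by rewrite ler_nat.
  rewrite -(ler_pM2r (mulr_gt0 m0' n0')).
  have -> : 17 / 10 * (x%:R / m%:R - x%:R / n%:R) * (m%:R * n%:R) = 17 / 10 * (x%:R * (n%:R - m%:R)) :> R.
    by field; rewrite !gt_eqF.
  move: fn; rewrite /full; set D := psi (y %/ n) => fn.
  have xnm3 := ler_wpM2l (ltW x0') nm3.
  have [hx1 hx2] := ratio_bounds x m0; have [hy1 hy2] := ratio_bounds y n0.
  have kx : k * x%:R <= (c - 1) / 1000 * x%:R.
    rewrite ler_pM2r //; have : b <= b * c by rewrite ler_peMr //; lra.
    by rewrite bc /k; lra.
  have fnm := ler_wpM2r (ltW m0') fn.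
  have kxm := ler_wpM2r (ltW m0') kx.
  have ylm := ler_wpM2r (ltW m0') yl.
  have xm0 : 0 <= (c - 1) * x%:R * m%:R by rewrite !mulr_ge0 ?ltW //; lra.
  (* If y / n does not pass x / m, the mass on (x / n, y / n] is enough: it is about 2 * 9/10 (c -
     1) x / n, and 18/10 exceeds 17/10 * 102/100. *)
  have [yx|xy] := leqP (y %/ n) (x %/ m).
    have DP : D <= P m by exact: psi_mono.
    have := ler_wpM2r (ltW (mulr_gt0 m0' n0')) DP.
    rewrite -/(P n) in fnm; lra.
  (* Otherwise the part beyond x / m is removed by means of the upper density 2. In units of x / n,
     the excess of density 2 over 17/10 is worth more than 3/10 b, and the two errors are at most k
     = b / 10 each. *)
  have st : x%:R / m%:R <= y%:R / n%:R :> R.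
    by apply: (le_trans hx2); apply: le_trans hy1; rewrite natr1 ler_nat.
  have Bs : Bi%:R <= x%:R / m%:R :> R.
    rewrite ler_pdivlMr // -natrM ler_nat; apply: leq_trans Bx.
    by rewrite leq_mul // ?(leq_trans mn) // leqW // leq_addr.
  have tQ : y%:R / n%:R <= (c + 1) * (x%:R / m%:R).
    rewrite ler_pdivrMr //; apply: (le_trans yu); rewrite -[leRHS]mulrA ler_pM2l; last lra.
    by rewrite mulrAC ler_pdivlMr // ler_pM2l.
  have I := HBi _ _ _ _ hx1 hx2 hy1 st Bs tQ; rewrite -/D -/(P m) in I.
  have := ler_wpM2r (ltW (mulr_gt0 m0' n0')) I.
  have -> : (2 * (y%:R / n%:R - x%:R / m%:R) + kappa * (x%:R / m%:R)) * (m%:R * n%:R) =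
     2 * (y%:R * m%:R - x%:R * n%:R) + x%:R * (kappa * n%:R) :> R.
    by field; rewrite !gt_eqF.
  have kn : kappa * n%:R <= k * m%:R.
    by rewrite -kapc -mulrA ler_pM2l.
  have km : k * m%:R = b * m%:R / 10 by rewrite /k; ring.
  have xkn := ler_wpM2l (ltW x0') kn.
  have xnm1 := ler_wpM2l (ltW x0') (ltW nm1).
  have xkm : x%:R * (k * m%:R) = x%:R * (b * m%:R) / 10 by rewrite km; ring.
  rewrite -/(P n) in fnm.
  have xbm : 0 <= x%:R * (b * m%:R) by rewrite mulr_ge0 ?ltW.
  lra.
(* Induction on the distance to the end of the window; the bounds telescope until the next search
   interval would leave the window, which happens only beyond W z / (2 c). *)
have chain j m : (W * z - m <= j)%N -> (z <= m)%N -> (m <= W * z)%N ->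
    exists n, [/\ (W * z)%:R <= 2 * c * n%:R, (z <= n)%N &
      17 / 10 * (x%:R / m%:R - x%:R / n%:R) <= P m - P n].
  elim: j m => [|j IH] m jm zm mW; have zm' : z%:R <= m%:R :> R by rewrite ler_nat.
    exists m; split=> //; last by rewrite !subrr mulr0.
    have -> : (W * z = m)%N by apply/eqP; rewrite eqn_leq mW -subn_eq0 andbT -leqn0.
    by rewrite ler_peMl //; lra.
  have bm := bz m zm.
  have bm0 : 0 <= (1 + b) * m%:R by rewrite mulr_ge0 //; lra.
  have /andP[t1 t2] := next_nat_bounds bm0.
  set t := next_nat ((1 + b) * m%:R) in t1 t2.
  have ct0 : 0 <= c * t%:R by rewrite mulr_ge0 //; lra.
  have /andP[u1 u2] := next_nat_bounds ct0.
  have mt : (m < t)%N by rewrite -(ltr_nat R); lra.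
  (* The two roundings cost c + 1 <= b m in all. As b c = (c - 1) / 100, the next n satisfies n - m
     <= 102/100 (c - 1) m. *)
  have ut : (next_nat (c * t%:R))%:R <= (c + 2 * (b * c)) * m%:R.
    have := ler_wpM2l (ltW (lt_trans ltr01 c1)) t2.
    have : b * m%:R <= b * m%:R * c by rewrite ler_peMr //; lra.
    lra.
  have m1 : (c - 1) * m%:R >= 0 by rewrite mulr_ge0 //; lra.
  have [uW|Wu] := leqP (next_nat (c * t%:R)) (W * z); last first.
    exists m; split=> //; last by rewrite !subrr mulr0.
    have : (W * z)%:R <= (next_nat (c * t%:R))%:R :> R by rewrite ler_nat ltnW.
    rewrite bc in ut; lra.
  have [n /andP[tn nu] fn] := win t (leq_trans zm (ltnW mt)) uW.
  have nu' : n%:R <= (next_nat (c * t%:R))%:R :> R by rewrite ler_nat.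
  have tn' : t%:R < n%:R :> R by rewrite ltr_nat.
  have nW : (n <= W * z)%N by apply: leq_trans uW.
  have Smn : 17 / 10 * (x%:R / m%:R - x%:R / n%:R) <= P m - P n.
    by apply: step => //; rewrite bc in ut; lra.
  have mn : (m < n)%N by apply: ltn_trans tn.
  have [||n' [h1 h2 h3]] := IH n _ _ nW.
  - by rewrite -ltnS; apply: leq_trans jm; apply: ltn_sub2l => //; apply: leq_trans nW.
  - by apply: leq_trans zm (ltnW mn).
  by exists n'; split=> //; lra.
have [|n [Wn zn]] := chain (W * z - z)%N z (leqnn _) (leqnn _).
  by rewrite leq_pmull // ltnW.
have n0' : 0 < n%:R :> R by rewrite ltr0n; apply: leq_trans zn.
(* Since W >= 200 c, the chain ends at n >= 100 z, and 17/10 * 99/100 exceeds 8/5. *)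
have zn' : 100 * z%:R <= n%:R :> R.
  rewrite -(ler_pM2l (_ : 0 < 2 * c)); last lra.
  apply: le_trans Wn; rewrite natrM; have := ler_wpM2r (ltW z0') HW; lra.
have xn : x%:R / n%:R <= x%:R / z%:R / 100 :> R.
  have -> : x%:R / z%:R / 100 = x%:R / (100 * z%:R) :> R by field; rewrite gt_eqF.
  by rewrite ler_pM2l // lef_pV2 ?posrE // mulr_gt0.
have [hx _] := ratio_bounds x z0.
have Xcx : (Xc <= x %/ z)%N.
  rewrite leq_divRL //; apply: leq_trans Bx; rewrite leq_mul ?leq_pmull ?(ltnW W1) //.
  by rewrite leqW // leq_addl.
have Pz := HXc _ Xcx; have Pn : 0 <= P n by exact: psi_ge0.
have xz0 : 0 < x%:R / z%:R :> R by rewrite divr_gt0.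
rewrite -/(P z) in Pz; lra.
Qed.

(** [psi_grows] allows arbitrarily large y, whereas the estimates need y = O(x); since psi is
    monotone, a gap up to y is also a gap up to the shorter endpoint. *)
Lemma truncate_interval (c : R) (x y : nat) : 0 <= c -> c * x%:R <= y%:R ->
  exists y0 : nat, [/\ c * x%:R <= y0%:R, y0%:R <= c * x%:R + 1 & (y0 <= y)%N].
Proof.
move=> c0 cxy; have cx0 : 0 <= c * x%:R by rewrite mulr_ge0.
have /andP[u1 u2] := next_nat_bounds cx0.
exists (minn y (next_nat (c * x%:R))); split; last exact: geq_minl.
  by rewrite /minn; case: ifP => // _; exact: ltW.
by apply: le_trans u2; rewrite ler_nat geq_minr.
Qed.

(** The constants are fixed in the order k and W, then rho, then kappa = rho k / 3. A gap of size
    kappa makes the weight of the numbers that are not full at most (3 kappa / k) ln x = rho ln x,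
    so a window as in [ex_full_window] exists, which [no_full_window] forbids. *)
Lemma psi_grows_step (c : R) : 1 < c -> psi_grows c -> psi_grows (1 + 9 / 10 * (c - 1)).
Proof.
move=> c1 gc; have [k [W [B1 [X1 [k0 W1 B10 X10 no]]]]] := no_full_window c1.
have [rho rho0 win] := ex_full_window c1 gc W1.
pose kappa := rho * k / 3; have kap0 : 0 < kappa by rewrite /kappa divr_gt0 // mulr_gt0.
have [B0 HB0] := @not_full_weight_le (c + 1) kappa k ltac:(lra) kap0 k0.
pose B := (B0 + B1)%N; have B0B : (B0 < B)%N by rewrite -addn1 leq_add2l.
have [X2 HX2] := HB0 B B0B; have [X3 HX3] := win X1 B X10 (leq_ltn_trans (leq0n _) B0B).
exists kappa => //; exists (X2 + X3).+1 => x y Xx cxy.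
have c'0 : 0 <= 1 + 9 / 10 * (c - 1) by lra.
have [y0 [l1 l2 y0y]] := truncate_interval c'0 cxy.
rewrite leNgt; apply/negP => gap.
have x1 : 1 <= x%:R :> R by rewrite ler1n; apply: leq_trans Xx.
have cx : 0 <= (c - 1) * x%:R by rewrite mulr_ge0 //; lra.
have l2' : y0%:R <= (c + 1) * x%:R by lra.
have xy0 : (x <= y0)%N by rewrite -(ler_nat R); lra.
have gap0 : psi y0 - psi x < kappa * x%:R.
  by apply: le_lt_trans gap; rewrite lerD2r psi_mono.
have X2x : (X2 <= x)%N by apply: leq_trans Xx; rewrite leqW // leq_addr.
have X3x : (X3 <= x)%N by apply: leq_trans Xx; rewrite leqW // leq_addl.
have := HX2 x y0 X2x xy0 l2' gap0.
have -> : 3 * kappa / k = rho by rewrite /kappa; field; rewrite gt_eqF.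
move=> /(HX3 x _ X3x)[z [zX zW full_z]]; apply: (no x y0 z zX _ l1 l2' full_z).
apply: leq_trans (leq_trunc_div x B); rewrite mulnC leq_mul // /B leq_addl //.
Qed.

Lemma psi_grows_mono (c c' : R) : c <= c' -> psi_grows c -> psi_grows c'.
Proof.
move=> cc' [delta delta0 [X HX]]; exists delta => //; exists X => x y Xx cxy.
by apply: HX => //; apply: le_trans cxy; rewrite ler_wpM2r.
Qed.

Lemma psi_grows_initial : exists2 c : R, 1 < c & psi_grows c.
Proof.
(* From psi y >= (y - 1) / 4 and y >= (4 K + 8) x, psi y exceeds K x by at least x. *)
have [K K0 HK] := psi_le; exists (4 * K + 8); first lra.
exists 1 => //; exists 1%N => x y x1 cxy.
have := HK x; have := psi_ge y.
have x1' : 1 <= x%:R :> R by rewrite ler1n.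
lra.
Qed.

Lemma psi_grows_gt1 (c : R) : 1 < c -> psi_grows c.
Proof.
move=> c1; have [u u1 gu] := psi_grows_initial.
have iter n : psi_grows (1 + (9 / 10) ^+ n * (u - 1)).
  elim: n => [|n IH]; first by rewrite expr0 mul1r addrC subrK.
  have h1 : 1 < 1 + (9 / 10) ^+ n * (u - 1) by rewrite ltrDl mulr_gt0 ?exprn_gt0 //; lra.
  have -> : 1 + (9 / 10) ^+ n.+1 * (u - 1) = 1 + 9 / 10 * (1 + (9 / 10) ^+ n * (u - 1) - 1).
    by rewrite exprS; ring.
  exact: psi_grows_step.
(* Bernoulli's inequality for (10 / 9) ^ n, so that the powers of 9/10 tend to 0. *)
have bern n : (9 / 10) ^+ n * (1 + n%:R / 9) <= 1 :> R.
  elim: n => [|n IH]; first by rewrite expr0 mul0r addr0 mulr1.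
  apply: le_trans IH; rewrite exprSr -mulrA ler_wpM2l ?exprn_ge0 //; first lra.
  have n0 : 0 <= n%:R :> R by rewrite ler0n.
  rewrite -[n.+1%:R]natr1; lra.
have [n Hn] := ex_nat_ge (9 * (u - 1) / (c - 1)).
apply: psi_grows_mono (iter n); rewrite -lerBrDl.
have c10 : 0 < c - 1 by lra.
have u10 : 0 < u - 1 by lra.
rewrite ler_pdivrMr // in Hn.
have q0 : 0 <= (9 / 10) ^+ n :> R by rewrite exprn_ge0 //; lra.
have := ler_wpM2r (ltW c10) (bern n); have := ler_wpM2l q0 Hn.
have := mulr_ge0 q0 (ltW c10); lra.
Qed.

(** A prime power p ^ k <= N with k >= 2 forces p <= sqrt N, and the powers of one p up to N
    contribute at most ln N together. *)
Lemma psi_nonprime_bound N : (0 < N)%N ->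
  \sum_(1 <= m < N.+1 | ~~ prime m) mangoldt m <= Num.sqrt N%:R * ln N%:R.
Proof.
move=> N0.
have -> : \sum_(1 <= m < N.+1 | ~~ prime m) mangoldt m = \sum_(1 <= m < N.+1 | ~~ prime m)
    \sum_(1 <= p < N.+1 | prime p) \sum_(1 <= k < N.+1 | m == (p ^ k)%N) ln p%:R.
  rewrite big_nat_cond [RHS]big_nat_cond; apply: eq_bigr => m /andP[/andP[m0 mN] _].
  by rewrite (@mangoldt_sum m N) // m0.
rewrite (exchange_big_dep prime) //=.
apply: (@le_trans _ _ (\sum_(1 <= p < N.+1 | (p < (Num.truncn (Num.sqrt N%:R : R)).+1)%N) ln N%:R)); last first.
  have s0 : 0 <= Num.sqrt N%:R :> R by exact: sqrtr_ge0.
  set r := Num.truncn _.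
  have rs : r%:R <= Num.sqrt N%:R :> R by rewrite truncn_le.
  have rN : (r < N.+1)%N.
    rewrite ltnS -(ler_nat R); apply: (le_trans rs).
    rewrite -[leRHS]sqr_sqrtr ?ler0n // expr2 ler_peMl //.
    by rewrite -[leLHS]sqrtr1 ler_sqrt ?ler1n // ltr0n.
  rewrite -(big_nat_widen _ _ _ predT) //.
  rewrite big_const_nat iter_addr addr0 subn1 /= -[ln _ *+ _]mulr_natl ler_wpM2r //.
  exact: ln_nat_ge0.
rewrite big_mkcond [leRHS]big_mkcond; apply: ler_sum_nat => p /andP[p0 pN].
case: ifP => [p_pr|_]; last first.
  by case: ifP => _; rewrite ?ln_nat_ge0.
rewrite (exchange_big_dep xpredT) //=.
have lnp : 0 <= ln p%:R :> R by exact: ln_nat_ge0.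
have p1 := prime_gt1 p_pr.
have inner k : \sum_(1 <= m < N.+1 | ~~ prime m && prime p && (m == (p ^ k)%N)) ln p%:R =
    if (p ^ k <= N)%N && ~~ prime (p ^ k) then ln p%:R else 0 :> R.
  by rewrite big_nat1_cond_eq expn_gt0 p0 ltnS p_pr andbT.
rewrite (eq_bigr _ (fun k _ => inner k)).
case: ifP => [_|/negbT pr]; last first.
  rewrite big_nat_cond big1 // => k /andP[/andP[k1 _] _]; case: ifP => // /andP[pkN npk].
  have k2 : (2 <= k)%N by case: k k1 npk {pkN} => [|[|k]] //; rewrite expn1 p_pr.
  case/negP: pr; have : (p ^ 2 <= N)%N by apply: leq_trans pkN; rewrite leq_exp2l.
  rewrite ltnS truncn_ge_nat ?sqrtr_ge0 // => p2N.
  rewrite -(@ler_sqr R) ?nnegrE ?sqrtr_ge0 // sqr_sqrtr ?ler0n //.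
  by rewrite -natrX ler_nat.
have TN : (trunc_log p N < N.+1)%N.
  by rewrite ltnS -(leq_exp2l _ _ p1); apply: leq_trans (trunc_logP p1 N0) _; apply/ltnW/ltn_expl.
apply: (@le_trans _ _ (\sum_(1 <= k < N.+1 | (k < (trunc_log p N).+1)%N) ln p%:R)).
  rewrite [leRHS]big_mkcond; apply: ler_sum_nat => k /andP[k1 _].
  case: ifP => [/andP[pkN _]|_]; last by case: ifP.
  by rewrite ltnS trunc_log_max.
rewrite -(big_nat_widen _ _ _ predT) //.
rewrite big_const_nat iter_addr addr0 subn1 /= -lnXn ?ltr0n // -natrX.
by rewrite ler_ln ?posrE ?ltr0n ?expn_gt0 ?p0 // ler_nat trunc_logP.
Qed.

Lemma psi_nonprime_small (eta : R) : 0 < eta -> exists X : nat, forall N, (X <= N)%N ->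
  \sum_(1 <= m < N.+1 | ~~ prime m) mangoldt m <= eta * N%:R.
Proof.
move=> e0; have [C C0 lnC] := @ln_le_linear (eta / 4) ltac:(lra).
have [M HM] := ex_nat_ge (4 * C / eta).
exists (M ^ 2).+1 => N MN; have N0 : (0 < N)%N by apply: leq_trans MN.
apply: le_trans (psi_nonprime_bound N0) _.
(* In terms of s the bound is 2 s ln s <= (eta / 2) s ^ 2 + 2 C s, and the last term is at most (eta
   / 2) s ^ 2 once 4 C <= eta s. *)
set s : R := Num.sqrt N%:R.
have s0 : 0 < s by rewrite sqrtr_gt0 ltr0n.
have Es : N%:R = s ^+ 2 :> R by rewrite sqr_sqrtr ?ler0n.
rewrite Es lnXn //.
have Ms : M%:R <= s.
  rewrite -(@ler_sqr R) ?nnegrE ?ler0n ?(ltW s0) // -Es -natrX ler_nat.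
  exact: ltnW.
have sC : 4 * C <= eta * s.
  by rewrite [leRHS]mulrC -ler_pdivrMr //; apply: le_trans HM Ms.
have := ler_wpM2l (ltW s0) (lnC s s0); have := ler_wpM2l (ltW s0) sC.
rewrite -mulr_natl; lra.
Qed.

Lemma prime_in_interval (c : R) : 1 < c -> exists X : nat, forall x y : nat, (X <= x)%N ->
  c * x%:R <= y%:R -> exists2 p, prime p & (x < p <= y)%N.
Proof.
move=> c1; have [delta delta0 [X HX]] := psi_grows_gt1 c1.
(* As y0 <= (c + 1) x, the proper prime powers up to y0 account for at most half of the mass delta
   x. *)
have e0 : 0 < delta / (2 * (c + 1)) by rewrite divr_gt0 //; lra.
have [X2 HX2] := psi_nonprime_small e0.
exists (X + X2).+1 => x y Xx cxy.
have c0 : 0 <= c by lra.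
have [y0 [l1 l2 y0y]] := truncate_interval c0 cxy.
have x1 : 1 <= x%:R :> R by rewrite ler1n; apply: leq_trans Xx.
have cx : 0 <= (c - 1) * x%:R by rewrite mulr_ge0 //; lra.
have xy0 : (x <= y0)%N by rewrite -(ler_nat R); lra.
have Xlx : (X <= x)%N by apply: leq_trans Xx; rewrite leqW // leq_addr.
have X2y : (X2 <= y0)%N by apply: leq_trans xy0; apply: leq_trans Xx; rewrite leqW // leq_addl.
apply: contrapT => no.
have low := HX x y0 Xlx l1; have up := HX2 y0 X2y.
have E : psi y0 - psi x <= \sum_(1 <= m < y0.+1 | ~~ prime m) mangoldt m.
  rewrite /psi [in X in X - _](@big_cat_nat _ _ _ x.+1 1 y0.+1) //= addrAC subrr add0r.
  rewrite [leRHS](@big_cat_nat _ _ _ x.+1 1 y0.+1) //=.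
  rewrite ler_wpDl ?sumr_ge0 // => [m _|]; first exact: mangoldt_ge0.
  rewrite [leRHS]big_mkcond; apply: ler_sum_nat => m /andP[xm my].
  case: (boolP (prime m)) => // pm; case: no; exists m => //.
  by rewrite xm; apply: leq_trans y0y.
have y0x : y0%:R <= (c + 1) * x%:R by lra.
have := ler_wpM2l (ltW e0) y0x.
have -> : delta / (2 * (c + 1)) * ((c + 1) * x%:R) = delta * x%:R / 2.
  by field; rewrite gt_eqF //; lra.
have : 0 < delta * x%:R by rewrite mulr_gt0 //; lra.
lra.
Qed.

End PrimesInShortIntervals.

(** * Choice of the prime and of the number of subdivided edges *)

Lemma even_complement (n p : nat) : ~~ odd n -> odd p -> (p < n)%N -> (n < p.*2)%N ->
  exists2 k, (k.*2 < p)%N & (p + 1 + k.*2)%N = n.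
Proof.
move=> n_even p_odd pn np; exists (n.-1 - p)./2; first lia.
have n_odd : odd n.-1 by case: n n_even pn {np} => [|m] //=; rewrite negbK.
rewrite even_halfK ?oddB ?n_odd ?p_odd //; last by lia.
lia.
Qed.

Theorem theorem1p3 (R : realType) (eps : R) (heps : 0 < eps) :
  exists n0 : nat, forall n : nat, (n0 <= n)%N -> ~~ odd n ->
    exists F : {set {set {set 'I_n}}},
      [/\ (1 - eps) * n%:R <= #|F|%:R,
          forall M, M \in F -> perfect_matching (@complete_graph n) M,
          forall M N, M \in F -> N \in F -> M != N -> [disjoint M & N]
        & forall M N, M \in F -> N \in F -> M != N -> perfect_pair M N].
Proof.
(* Capping at 1/2 makes p > n / 2, which leaves enough nonzero residues for the new vertices. *)
pose e := Num.min eps (1 / 2).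
have e0 : 0 < e by rewrite lt_min heps; lra.
have e_eps : e <= eps by rewrite ge_min lexx.
have e2 : e <= 1 / 2 by rewrite ge_min lexx orbT.
(* The ratio 1 + e / 2 fits between (1 - e) n and n - 1: (1 + e / 2) (1 - e) n <= n - e n / 2 <= n -
   1 as soon as e n >= 2. *)
have [|X HX] := @prime_in_interval R (1 + e / 2); first lra.
have [m Hm] := ex_nat_ge (2 / e).
exists (m + 2 * X + 6)%N => n n0n n_even.
have n0 : m%:R + 2 * X%:R + 6 <= n%:R :> R by rewrite -natrM -!natrD ler_nat.
have m0 : 0 <= m%:R :> R by rewrite ler0n.
have X0 : 0 <= X%:R :> R by rewrite ler0n.
have en : 2 <= e * n%:R by rewrite mulrC -ler_pdivrMr //; lra.
have e_half : e * n%:R <= 1 / 2 * n%:R by rewrite ler_wpM2r.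
have n_ge0 : 0 <= (1 - e) * n%:R by lra.
have /andP[xl xu] := truncn_itv n_ge0.
set x := Num.truncn _ in xl xu; rewrite -natr1 in xu.
have [||p p_pr /andP[xp pn]] := HX x n.-1.
- by rewrite -(ler_nat R); lra.
- have -> : n.-1%:R = n%:R - 1 :> R by rewrite -subn1 natrB // -(ltr0n R); lra.
  have h : 0 <= 1 + e / 2 by lra.
  have := ler_wpM2l h xl; have := ler_wpM2l (ltW e0) en; lra.
have xp' : x%:R + 1 <= p%:R :> R by rewrite natr1 ler_nat.
have np : (n < p.*2)%N by rewrite -(ltr_nat R) -muln2 natrM; lra.
have n_gt1 : (1 < n)%N by rewrite -(ltr_nat R); lra.
have p_odd : odd p.
  case: (even_prime p_pr) => // p2; have : (4 < n)%N by rewrite -(ltr_nat R); lra.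
  by rewrite ltnNge ltnW // (leq_trans np) ?p2.
have pn' : (p < n)%N by apply: leq_ltn_trans pn _; rewrite prednK // ltnW.
have [k kp En] := even_complement n_even p_odd pn' np.
have [F [cF F1 F2 F3]] := perfect_family_of_prime p_pr p_odd kp.
move: F cF F1 F2 F3; rewrite En => F cF F1 F2 F3.
by exists F; split=> //; rewrite cF; have := ler_wpM2r (ler0n R n) e_eps; lra.
Qed.
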